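(* Let $u$ be a smooth solution in $\bar Q_T$ of the initial-boundary value problem $$\partial_t^2u-Lu=f\ \text{ in }Q_T,\qquad u|_{\Gamma_T}=g,\quad u|_{t=0}=u_0,\quad \partial_tu|_{t=0}=u_1\ \text{ in }\Omega,$$ where $L=a_1^2\partial_1^2+\ldots+a_n^2\partial_n^2$. Let $0\leq\varepsilon<1$ and $0<\varepsilon_0<1$ be fixed. Suppose that the mesh steps satisfy $$\tfrac13 h_t^2\Big(\tfrac{a_1^2}{h_1^2}+\ldots+\tfrac{a_n^2}{h_n^2}\Big)\leq 1-\varepsilon\qquad\text{and}\qquad \tfrac14 h_t^2A_{\mathbf h}\leq(1-\varepsilon_0^2)I\ \text{ in }H_h.$$ Let $v$ (on $\bar\omega_h\times\{t_m\}_{m=0}^M$) and $v_{11},\ldots,v_{nn}$ (on $\bar\omega_h\times\{t_m\}_{m=0}^{M-1}$) be the solution of the scheme $$\Lambda_tv^m=\big(I+\tfrac1{12}h_t^2L_h\big)\big(a_1^2v_{11}^m+\ldots+a_n^2v_{nn}^m\big)+f_{\mathbf h}^m\ \text{ on }\omega_h,\quad 1\leq m\leq M-1,$$ $$s_{kN}v_{kk}^m=\Lambda_kv^m\ \text{ on }\omega_h,\quad 0\leq m\leq M-1,\ 1\leq k\leq n,$$ $$(\delta_tv)^0=\tfrac12h_t\big(I+\tfrac1{12}h_t^2L_h\big)\big(a_1^2v_{11}^0+\ldots+a_n^2v_{nn}^0\big)+u_{1\mathbf h}+\tfrac12h_tf_{\mathbf h}^0\ \text{ on }\omega_h,$$ with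 the boundary conditions $v^m=g$ on $\partial\omega_h$ for $1\leq m\leq M$ and $a_k^2v_{kk}^m=g_k$ on $\partial\omega_h$ for $0\leq m\leq M-1$, $1\leq k\leq n$, and with $v^0=u_0$ on $\bar\omega_h$. Then the following 4th order error bound in the mesh energy norm holds: $$\max_{1\leq m\leq M}\big(\varepsilon_0\|\bar\delta_t(u-v)^m\|_h+\sqrt{\varepsilon}\,\|\bar s_t(u-v)^m\|_{-L_h}\big)=\mathcal O(|h|^4).$$
   Context: Let $n\geq1$, $a_k>0$, $X_k>0$ ($1\leq k\leq n$), $T>0$ be constants, $\Omega=(0,X_1)\times\ldots\times(0,X_n)$, $Q_T=\Omega\times(0,T)$, $\Gamma_T=\partial\Omega\times(0,T)$. ''Smooth'' means infinitely (or sufficiently many times continuously) differentiable up to the closure; the data $f,g,u_0,u_1$ are then correspondingly smooth. Time mesh: $t_m=mh_t$, $0\leq m\leq M$, $h_t=T/M$, $M\geq2$. With $y^m=y(t_m)$: $\bar s_ty^m=\tfrac12(y^{m-1}+y^m)$, $\bar\delta_ty^m=\frac{y^m-y^{m-1}}{h_t}$, $\delta_ty^m=\frac{y^{m+1}-y^m}{h_t}$, $\Lambda_ty^m=\frac{y^{m+1}-2y^m+y^{m-1}}{h_t^2}$. Space mesh: $x_{kl}=lh_k$, $0\leq l\leq N_k$, $h_k=X_k/N_k$, $N_k\geq2$ an integer; $\bar\omega_h$ is the product of the one-dimensional meshes $\{x_{kl}\}_{l=0}^{N_k}$, $1\le k\le n$, $\omega_h$ is the product of $\{x_{kl}\}_{l=1}^{N_k-1}$,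 and $\partial\omega_h=\bar\omega_h\setminus\omega_h$; $h=(h_1,\ldots,h_n)$, $\mathbf h=(h,h_t)$, and $|h|$, $|\mathbf h|$ are Euclidean lengths. In the direction $x_k$ on $\omega_h$: $(\Lambda_kw)_l=\frac{1}{h_k^2}(w_{l+1}-2w_l+w_{l-1})$ and $s_{kN}w_l=\frac1{12}(w_{l-1}+10w_l+w_{l+1})$, i.e. $s_{kN}=I+\frac1{12}h_k^2\Lambda_k$; $L_h=a_1^2\Lambda_1+\ldots+a_n^2\Lambda_n$; $I$ is the identity. Applied to functions on $\bar\omega_h$ these give functions on $\omega_h$. $H_h$ is the Euclidean space of real functions on $\bar\omega_h$ vanishing on $\partial\omega_h$ with inner product $(v,w)_h=h_1\cdots h_n\sum_{x\in\omega_h}v(x)w(x)$ and norm $\|w\|_h=(w,w)_h^{1/2}$. On $H_h$ the operators $\Lambda_k,s_{kN},L_h$ are regarded as operators in $H_h$ (values on $\partial\omega_h$ set to $0$); $s_{kN}$ is invertible and $-L_h=(-L_h)^*>0$ in $H_h$. Operator inequalities in $H_h$ are in the sense of quadratic forms. $\|w\|_{-L_h}=(-L_hw,w)_h^{1/2}$. $A_{\mathbf h}:=\big(I+\tfrac1{12}h_t^2L_h\big)\big(-a_1^2s_{1N}^{-1}\Lambda_1-\ldots-a_n^2s_{nN}^{-1}\Lambda_n\big)$ in $H_h$. Data of the scheme: for $1\leq m\leq M-1$, $f_{\mathbf h}:=f+\tfrac1{12}h_t^2(L_h+\Lambda_t)f$ on $\omega_h$. For the first level, $u_{1\mathbf h}=\big(I+\tfrac16h_t^2L_h\big)u_1$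 and $f_{\mathbf h}^0=f_{dh_t}^{(0)}+\tfrac1{12}h_t^2L_hf^0$ on $\omega_h$, where $f^0=f|_{t=0}$ and $f_{dh_t}^{(0)}$ is any mesh function with $f_{dh_t}^{(0)}=f|_{t=0}+\tfrac13h_t(\partial_tf)|_{t=0}+\tfrac1{12}h_t^2(\partial_t^2f)|_{t=0}+\mathcal O(h_t^3)$ uniformly on $\omega_h$. Boundary data on $\bar\Gamma_T$: $g_k:=\partial_t^2g-\sum_{1\leq l\leq n,\,l\neq k}a_l^2\partial_l^2g-f$ for $x_k=0,X_k$, and $g_k:=a_k^2\partial_k^2g$ for $x_l=0,X_l$ with $l\neq k$ (so $g_k=a_k^2\partial_k^2u$ on $\bar\Gamma_T$). The notation $\mathcal O(|h|^4)$ means: bounded by $C|h|^4$ with $C$ independent of the mesh (i.e. of $h$, $h_t$, $M$, $N_k$), for all meshes satisfying the two stated conditions; $C$ may depend on $u$, the data, $n$, $a_k$, $X_k$, $T$, $\varepsilon$, $\varepsilon_0$ (and on the constant in the assumption on $f_{dh_t}^{(0)}$). *)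

(* Defs.v *)
From HB Require Import structures.
From mathcomp Require Import all_boot all_order all_algebra.
From mathcomp Require Import all_classical all_reals all_analysis.
Set Implicit Arguments.
Unset Strict Implicit.
Unset Printing Implicit Defensive.
Import Order.TTheory GRing.Theory Num.Theory.
Import numFieldNormedType.Exports.
Local Open Scope classical_set_scope.
Local Open Scope ring_scope.

(* A space-time point is a pair (x, t) with x : 'rV[R]_n; the k-th space
   coordinate of x is x 0 k. *)

Definition Omega (R : realType) n (X : 'I_n -> R) : set 'rV[R]_n :=
  [set x | forall k, 0 < x 0 k < X k].

Definition Omegabar (R : realType) n (X : 'I_n -> R) : set 'rV[R]_n :=
  [set x | forall k, 0 <= x 0 k <= X k].

Definition bdOmega (R : realType) n (X : 'I_n -> R) : set 'rV[R]_n :=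
  Omegabar X `\` Omega X.

Definition QT (R : realType) n (X : 'I_n -> R) (T : R) : set ('rV[R]_n * R) :=
  [set p | Omega X p.1 /\ 0 < p.2 < T].

Definition QTbar (R : realType) n (X : 'I_n -> R) (T : R) :
    set ('rV[R]_n * R) :=
  [set p | Omegabar X p.1 /\ 0 <= p.2 <= T].

Definition GammaT (R : realType) n (X : 'I_n -> R) (T : R) :
    set ('rV[R]_n * R) :=
  [set p | bdOmega X p.1 /\ 0 < p.2 < T].

Definition GammaTbar (R : realType) n (X : 'I_n -> R) (T : R) :
    set ('rV[R]_n * R) :=
  [set p | bdOmega X p.1 /\ 0 <= p.2 <= T].

(* Derivative relative to a set A of reals. For A = `[0, X] it is the usual
   two-sided derivative on `]0, X[ and the one-sided one at 0 and X. *)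
Definition diff_quot_on (R : realType) (A : set R) (phi : R -> R) (s : R) :
    set_system R :=
  (fun r => (phi r - phi s) / (r - s)) @ within A (s^').

Definition derivable_on (R : realType) (A : set R) (phi : R -> R) (s : R) :
    Prop :=
  cvg (diff_quot_on A phi s).

Definition derive_on (R : realType) (A : set R) (phi : R -> R) (s : R) : R :=
  lim (diff_quot_on A phi s).

Definition set_coord (R : realType) n (x : 'rV[R]_n) (k : 'I_n) (s : R) :
    'rV[R]_n :=
  \row_j (if j == k then s else x 0 j).

(* Directions of differentiation: Some k is x_k, None is t. *)
Definition slice (R : realType) n (i : option 'I_n) (w : 'rV[R]_n * R -> R)
    (p : 'rV[R]_n * R) : R -> R :=
  fun s => if i is Some k then w (set_coord p.1 k s, p.2) else w (p.1, s).

Definition coord (R : realType) n (i : option 'I_n) (p : 'rV[R]_n * R) : R :=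
  if i is Some k then p.1 0 k else p.2.

Definition range_of (R : realType) n (X : 'I_n -> R) (T : R)
    (i : option 'I_n) : set R :=
  [set s | 0 <= s <= (if i is Some k then X k else T)].

(* Partial derivatives on the closed cylinder (one-sided on its faces). They
   also make sense for functions given only on a face of the lateral surface,
   provided that the direction i is tangential to this face. *)
Definition pderivable (R : realType) n (X : 'I_n -> R) (T : R)
    (i : option 'I_n) (w : 'rV[R]_n * R -> R) (p : 'rV[R]_n * R) : Prop :=
  derivable_on (range_of X T i) (slice i w p) (coord i p).

Definition pd (R : realType) n (X : 'I_n -> R) (T : R)
    (i : option 'I_n) (w : 'rV[R]_n * R -> R) : 'rV[R]_n * R -> R :=
  fun p => derive_on (range_of X T i) (slice i w p) (coord i p).

(* w is K times continuously differentiable up to the closure: all iterated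
   partial derivatives of order at most K exist on the closed cylinder and are
   continuous there. *)
Definition smooth_upto (R : realType) n (X : 'I_n -> R) (T : R) (K : nat)
    (w : 'rV[R]_n * R -> R) : Prop :=
  forall s : seq (option 'I_n), (size s <= K)%N ->
    {within QTbar X T, continuous (foldr (pd X T) w s)} /\
    ((size s < K)%N -> forall i p, QTbar X T p ->
       pderivable X T i (foldr (pd X T) w s) p).

Definition pd2 (R : realType) n (X : 'I_n -> R) (T : R) (i : option 'I_n)
    (w : 'rV[R]_n * R -> R) : 'rV[R]_n * R -> R :=
  pd X T i (pd X T i w).

Definition Lop (R : realType) n (a X : 'I_n -> R) (T : R)
    (w : 'rV[R]_n * R -> R) (p : 'rV[R]_n * R) : R :=
  \sum_(k < n) a k ^+ 2 * pd2 X T (Some k) w p.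

(* The boundary data g_k. Where x_k = 0, X_k meets x_l = 0, X_l, l <> k, the
   two formulas agree (both give a_k^2 d_k^2 u), and the first one is taken. *)
Definition bdata (R : realType) n (a X : 'I_n -> R) (T : R)
    (f g : 'rV[R]_n * R -> R) (k : 'I_n) (p : 'rV[R]_n * R) : R :=
  if (p.1 0 k == 0) || (p.1 0 k == X k) then
    pd2 X T None g p
      - (\sum_(l < n | l != k) a l ^+ 2 * pd2 X T (Some l) g p) - f p
  else a k ^+ 2 * pd2 X T (Some k) g p.

(* Multi-indices l of the nodes of the closed space mesh, 0 <= l_k <= N_k. *)
Definition grid n (N : 'I_n -> nat) : finType :=
  {dffun forall k : 'I_n, 'I_(N k).+1}.

Definition meshfun (R : realType) n (N : 'I_n -> nat) := {ffun grid N -> R}.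

Definition node (R : realType) n (N : 'I_n -> nat) (h : 'I_n -> R)
    (l : grid N) : 'rV[R]_n :=
  \row_k ((l k)%:R * h k).

Definition omega_h n (N : 'I_n -> nat) : {set grid N} :=
  [set l : grid N | [forall k, 0 < l k < N k]%N]%SET.

Definition bd_omega_h n (N : 'I_n -> nat) : {set grid N} :=
  (~: omega_h N)%SET.

(* Neighbours in the direction x_k, to be used at interior nodes only. *)
Definition next_node n (N : 'I_n -> nat) (k : 'I_n) (l : grid N) : grid N :=
  [ffun j => if j == k then inord (l j).+1 else l j].

Definition prev_node n (N : 'I_n -> nat) (k : 'I_n) (l : grid N) : grid N :=
  [ffun j => if j == k then inord (l j).-1 else l j].

(* Mesh operators take functions on the closed mesh to functions on omega_h,
   the values on the boundary nodes being set to 0. *)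
Definition Lam (R : realType) n (N : 'I_n -> nat) (h : 'I_n -> R) (k : 'I_n)
    (w : meshfun R N) : meshfun R N :=
  [ffun l => if l \in omega_h N then
     (w (next_node k l) - 2 * w l + w (prev_node k l)) / h k ^+ 2 else 0].

Definition sN (R : realType) n (N : 'I_n -> nat) (k : 'I_n)
    (w : meshfun R N) : meshfun R N :=
  [ffun l => if l \in omega_h N then
     (w (prev_node k l) + 10 * w l + w (next_node k l)) / 12 else 0].

Definition Lh (R : realType) n (N : 'I_n -> nat) (a h : 'I_n -> R)
    (w : meshfun R N) : meshfun R N :=
  [ffun l => \sum_(k < n) a k ^+ 2 * Lam h k w l].

(* I + c L_h; on boundary nodes it is the identity. *)
Definition I_plus_Lh (R : realType) n (N : 'I_n -> nat) (a h : 'I_n -> R)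
    (c : R) (w : meshfun R N) : meshfun R N :=
  [ffun l => w l + c * Lh a h w l].

Definition Hh (R : realType) n (N : 'I_n -> nat) : set (meshfun R N) :=
  [set w | forall l, l \in bd_omega_h N -> w l = 0].

Definition inner_h (R : realType) n (N : 'I_n -> nat) (h : 'I_n -> R)
    (v w : meshfun R N) : R :=
  (\prod_(k < n) h k) * \sum_(l in omega_h N) v l * w l.

Definition norm_h (R : realType) n (N : 'I_n -> nat) (h : 'I_n -> R)
    (w : meshfun R N) : R :=
  Num.sqrt (inner_h h w w).

Definition norm_Lh (R : realType) n (N : 'I_n -> nat) (a h : 'I_n -> R)
    (w : meshfun R N) : R :=
  Num.sqrt (inner_h h (- Lh a h w) w).

(* The inverse of s_{kN} in H_h. For w in H_h the set below is a singleton,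
   the restriction of s_{kN} to H_h being strictly diagonally dominant. *)
Definition sN_inv (R : realType) n (N : 'I_n -> nat) (k : 'I_n)
    (w : meshfun R N) : meshfun R N :=
  xget 0 [set z | Hh z /\ sN k z = w].

Definition Ah (R : realType) n (N : 'I_n -> nat) (a h : 'I_n -> R) (ht : R)
    (w : meshfun R N) : meshfun R N :=
  I_plus_Lh a h (ht ^+ 2 / 12)
    [ffun l => - (\sum_(k < n) a k ^+ 2 * sN_inv k (Lam h k w) l)].

(* B <= C in H_h in the sense of quadratic forms. *)
Definition le_Hh (R : realType) n (N : 'I_n -> nat) (h : 'I_n -> R)
    (B C : meshfun R N -> meshfun R N) : Prop :=
  forall w, Hh w -> inner_h h (B w) w <= inner_h h (C w) w.

Definition scale_mesh (R : realType) n (N : 'I_n -> nat) (c : R)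
    (w : meshfun R N) : meshfun R N :=
  [ffun l => c * w l].

Definition Lam_t (R : realType) n (N : 'I_n -> nat) (ht : R)
    (y : nat -> meshfun R N) (m : nat) : meshfun R N :=
  [ffun l => (y m.+1 l - 2 * y m l + y m.-1 l) / ht ^+ 2].

Definition delta_t (R : realType) n (N : 'I_n -> nat) (ht : R)
    (y : nat -> meshfun R N) (m : nat) : meshfun R N :=
  [ffun l => (y m.+1 l - y m l) / ht].

Definition bdelta_t (R : realType) n (N : 'I_n -> nat) (ht : R)
    (y : nat -> meshfun R N) (m : nat) : meshfun R N :=
  [ffun l => (y m l - y m.-1 l) / ht].

Definition bs_t (R : realType) n (N : 'I_n -> nat)
    (y : nat -> meshfun R N) (m : nat) : meshfun R N :=
  [ffun l => (y m.-1 l + y m l) / 2].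

Definition restr (R : realType) n (N : 'I_n -> nat) (h : 'I_n -> R)
    (w : 'rV[R]_n -> R) : meshfun R N :=
  [ffun l => w (node h l)].

Definition restr_t (R : realType) n (N : 'I_n -> nat) (h : 'I_n -> R) (ht : R)
    (w : 'rV[R]_n * R -> R) (m : nat) : meshfun R N :=
  [ffun l => w (node h l, m%:R * ht)].

(* a_1^2 z_1 + ... + a_n^2 z_n *)
Definition wsum (R : realType) n (N : 'I_n -> nat) (a : 'I_n -> R)
    (z : 'I_n -> meshfun R N) : meshfun R N :=
  [ffun l => \sum_(k < n) a k ^+ 2 * z k l].

Definition fh (R : realType) n (N : 'I_n -> nat) (a h : 'I_n -> R) (ht : R)
    (f : 'rV[R]_n * R -> R) (m : nat) : meshfun R N :=
  let F := restr_t N h ht f in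
  [ffun l => F m l + ht ^+ 2 / 12 * (Lh a h (F m) l + Lam_t ht F m l)].

(* u solves the initial-boundary value problem. The data are required to be
   continuous up to the closure of their domains, so that f, g, u_0, u_1
   coincide there with the corresponding expressions in u and inherit their
   smoothness from u. *)
Record ibvp (R : realType) n (a X : 'I_n -> R) (T : R)
    (u f g : 'rV[R]_n * R -> R) (u0 u1 : 'rV[R]_n -> R) : Prop := Ibvp {
  ibvp_f_cont : {within QTbar X T, continuous f};
  ibvp_g_cont : {within GammaTbar X T, continuous g};
  ibvp_u0_cont : {within Omegabar X, continuous u0};
  ibvp_u1_cont : {within Omegabar X, continuous u1};
  ibvp_eq : forall p, QT X T p -> pd2 X T None u p - Lop a X T u p = f p;
  ibvp_bd : forall p, GammaT X T p -> u p = g p;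
  ibvp_init0 : forall x, Omega X x -> u (x, 0) = u0 x;
  ibvp_init1 : forall x, Omega X x -> pd X T None u (x, 0) = u1 x
}.

(* v and vv k = v_{kk} solve the scheme; fd is the mesh function f_{d h_t}^(0).
   Only the values v m, m <= M, and vv k m, m < M, are relevant. *)
Record scheme (R : realType) n (N : 'I_n -> nat) (M : nat) (a X : 'I_n -> R)
    (T : R) (h : 'I_n -> R) (ht : R)
    (f g : 'rV[R]_n * R -> R) (u0 u1 : 'rV[R]_n -> R) (fd : meshfun R N)
    (v : nat -> meshfun R N) (vv : 'I_n -> nat -> meshfun R N) : Prop :=
  Scheme {
  scheme_main : forall m l, (1 <= m <= M.-1)%N -> l \in omega_h N ->
    Lam_t ht v m l =
      I_plus_Lh a h (ht ^+ 2 / 12) (wsum a (vv ^~ m)) l + fh N a h ht f m l;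
  scheme_aux : forall k m l, (m <= M.-1)%N -> l \in omega_h N ->
    sN k (vv k m) l = Lam h k (v m) l;
  scheme_first : forall l, l \in omega_h N ->
    delta_t ht v 0 l =
      ht / 2 * I_plus_Lh a h (ht ^+ 2 / 12) (wsum a (vv ^~ 0%N)) l
      + I_plus_Lh a h (ht ^+ 2 / 6) (restr N h u1) l
      + ht / 2 * (fd l + ht ^+ 2 / 12 * Lh a h (restr_t N h ht f 0) l);
  scheme_bd : forall m l, (1 <= m <= M)%N -> l \in bd_omega_h N ->
    v m l = g (node h l, m%:R * ht);
  scheme_bd_aux : forall k m l, (m <= M.-1)%N -> l \in bd_omega_h N ->
    a k ^+ 2 * vv k m l = bdata a X T f g k (node h l, m%:R * ht);
  scheme_init : forall l, v 0%N l = u0 (node h l)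
}.

(* Main.v *)
(* Substituting the auxiliary unknowns, whose errors vanish on the boundary,
   turns the scheme for r = u - v into
     Lambda_t r = - A_h r + Psi,  r^0 = 0,  (delta_t r)^0 = Psi^0,
   where Psi collects the Numerov residuals, multiplied by the inverses of the
   s_kN and by I + h_t^2/12 L_h (bounded uniformly in the mesh), and the
   residual of the main equation.  Both are O(|h|^4) by Taylor's formula, the
   equation differentiated twice in t, and h_t = O(|h|), which the first mesh
   condition forces.
   The energy |delta r^m|^2 + (A_h r^(m-1), r^m) equals
   |delta r^m|^2 - h_t^2/4 (A_h delta r^m, delta r^m) + (A_h s r^m, s r^m), with
   delta and s the backward difference and half-sum; the second mesh condition
   and A_h >= eps (- L_h) bound it from below.  The latter holds because A_h is
   a product of commuting symmetric operators, I + h_t^2/12 L_h >= eps I and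
   - sum_k a_k^2 s_kN^-1 Lambda_k >= - L_h. *)
Require Import Defs.
From HB Require Import structures.
From mathcomp Require Import all_boot all_order all_algebra.
From mathcomp Require Import all_classical all_reals all_analysis.
From mathcomp Require Import ring lra.
Set Implicit Arguments.
Unset Strict Implicit.
Unset Printing Implicit Defensive.
Import Order.TTheory GRing.Theory Num.Theory.
Import numFieldNormedType.Exports.
Local Open Scope classical_set_scope.
Local Open Scope ring_scope.

(** The inequality A_h >= eps (- L_h) is obtained without common eigenfunctions of the mesh
    operators: positivity of a product of two commuting positive operators comes from a sequence of
    polynomials in one factor. The same fact bounds the norm of I + h_t^2/12 L_h by 1, since this
    operator lies between eps I and I. The operators are extended from H_h to all mesh functions
    through the projection that kills boundary values, so that symmetry and commutation carry no
    side conditions. Estimates use the unweighted Euclidean form; the number of nodes then enters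
    every norm and is absorbed at the end by the weight h_1 ... h_n. The order of the main residual
    rests on a cancellation: by the twice differentiated equation, L_h d_t^2 u + Lambda_t f
    reproduces the fourth time derivative of u up to second order. No residual needs more than six
    derivatives of u. The data are assumed continuous and tied to u on open sets; closures are
    reached by density, and the derivatives of f and g are read off from u. *)

Section SymmetricOperators.
Variables (R : realType) (I : finType).
Local Notation V := {ffun I -> R}.
Implicit Types (u v w : V) (F G P B : V -> V).

(** * Euclidean form, symmetric maps and their positivity *)

Definition dot v w : R := \sum_i v i * w i.

Definition sym F := forall v w, dot (F v) w = dot v (F w).

Definition psd F := forall w, 0 <= dot (F w) w.

Lemma dotC v w : dot v w = dot w v.
Proof. by apply: eq_bigr => i _; rewrite mulrC. Qed.

Lemma dotDl u v w : dot (u + v) w = dot u w + dot v w.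
Proof. by rewrite -big_split; apply: eq_bigr => i _; rewrite ffunE mulrDl. Qed.

Lemma dotZl c v w : dot (c *: v) w = c * dot v w.
Proof. by rewrite mulr_sumr; apply: eq_bigr => i _; rewrite ffunE mulrA. Qed.

Lemma dotNl v w : dot (- v) w = - dot v w.
Proof. by rewrite -scaleN1r dotZl mulN1r. Qed.

Lemma dotBl u v w : dot (u - v) w = dot u w - dot v w.
Proof. by rewrite dotDl dotNl. Qed.

Lemma dotDr u v w : dot w (u + v) = dot w u + dot w v.
Proof. by rewrite dotC dotDl !(dotC w). Qed.

Lemma dotZr c v w : dot w (c *: v) = c * dot w v.
Proof. by rewrite dotC dotZl (dotC w). Qed.

Lemma dotNr v w : dot w (- v) = - dot w v.
Proof. by rewrite dotC dotNl (dotC w). Qed.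

Lemma dotBr u v w : dot w (u - v) = dot w u - dot w v.
Proof. by rewrite dotDr dotNr. Qed.

Definition dotE := (dotDl, dotDr, dotNl, dotNr, dotZl, dotZr).

Lemma dot0l w : dot 0 w = 0.
Proof. by rewrite -(scale0r 0) dotZl mul0r. Qed.

Lemma dot_suml (J : finType) (F : J -> V) w :
  dot (\sum_j F j) w = \sum_j dot (F j) w.
Proof.
elim/big_ind2: _ => [|x a y b <- <-|//]; first exact: dot0l.
by rewrite dotDl.
Qed.

Lemma dot_ge0 w : 0 <= dot w w.
Proof. by apply: sumr_ge0 => i _; rewrite -expr2 sqr_ge0. Qed.

Lemma dot_eq0 w : dot w w = 0 -> w = 0.
Proof.
move=> /eqP; rewrite psumr_eq0 => [/allP w0|i _]; last by rewrite -expr2 sqr_ge0.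
apply/ffunP => i; rewrite ffunE; apply/eqP.
by rewrite -sqrf_eq0 expr2 (implyP (w0 i (mem_index_enum _))).
Qed.

Lemma dot_inj u v : (forall w, dot u w = dot v w) -> u = v.
Proof.
by move=> uv; apply/subr0_eq/dot_eq0; rewrite dotBl uv subrr.
Qed.

Lemma dot_cauchy v w : dot v w ^+ 2 <= dot v v * dot w w.
Proof.
have [/dot_eq0 ->|w0] := eqVneq (dot w w) 0; first by rewrite (dotC v) !dot0l expr0n mulr0.
have wgt0 : 0 < dot w w by rewrite lt_def w0 dot_ge0.
have := dot_ge0 (dot w w *: v - dot v w *: w).
rewrite !dotE (dotC w v).
set a := dot v v; set b := dot v w; set c := dot w w => H.
have : 0 <= c * (a * c - b ^+ 2) by move: H; rewrite -/c; nra.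
by rewrite pmulr_rge0// subr_ge0.
Qed.

Definition nrm w := Num.sqrt (dot w w).

Lemma nrm_ge0 w : 0 <= nrm w. Proof. exact: sqrtr_ge0. Qed.

Lemma sqr_nrm w : nrm w ^+ 2 = dot w w.
Proof. by rewrite sqr_sqrtr// dot_ge0. Qed.

Lemma dot_le_nrm v w : dot v w <= nrm v * nrm w.
Proof.
have := dot_cauchy v w; rewrite -!sqr_nrm -exprMn => H.
apply: le_trans (ler_norm _) _; rewrite -ler_sqr ?nnegrE ?mulr_ge0 ?nrm_ge0//.
by rewrite real_normK ?num_real.
Qed.

Lemma nrmD v w : nrm (v + w) <= nrm v + nrm w.
Proof.
rewrite -ler_sqr ?nnegrE ?addr_ge0 ?nrm_ge0// sqr_nrm !dotE sqrrD !sqr_nrm (dotC w v).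
by have := dot_le_nrm v w; lra.
Qed.

Lemma nrmZ c v : nrm (c *: v) = `|c| * nrm v.
Proof. by rewrite /nrm dotZl dotZr mulrA -expr2 sqrtrM ?sqr_ge0// sqrtr_sqr. Qed.

Lemma nrm_sum (J : finType) (F : J -> V) : nrm (\sum_j F j) <= \sum_j nrm (F j).
Proof.
elim/big_ind2: _ => [|x a y b xa yb|//].
  by rewrite /nrm dot0l sqrtr0.
by apply: le_trans (nrmD _ _) _; exact: lerD.
Qed.

(** Symmetry with respect to a nondegenerate form already forces linearity, so the mesh operators
    get linearity from their symmetry. *)
Lemma symD F : sym F -> {morph F : v w / v + w}.
Proof. by move=> sF v w; apply: dot_inj => z; rewrite !(sF, dotDl). Qed.

Lemma symZ F : sym F -> forall c, {morph F : v / c *: v}.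
Proof. by move=> sF c v; apply: dot_inj => z; rewrite !(sF, dotZl). Qed.

Lemma symN F : sym F -> {morph F : v / - v}.
Proof. by move=> sF v; rewrite -scaleN1r symZ// scaleN1r. Qed.

Lemma symB F : sym F -> {morph F : v w / v - w}.
Proof. by move=> sF v w; rewrite symD// symN. Qed.

Lemma sym0 F : sym F -> F 0 = 0.
Proof. by move=> sF; rewrite -{1}(scale0r (0 : V)) symZ// scale0r. Qed.

Lemma sym_sum F (J : finType) (v : J -> V) : sym F ->
  F (\sum_j v j) = \sum_j F (v j).
Proof.
by move=> sF; exact: (big_morph F (symD sF) (sym0 sF)).
Qed.

Lemma sym_linear F : sym F -> linear F.
Proof. by move=> sF c v w; rewrite symD// symZ. Qed.

(* The sequence [P_0 = P], [P_(i+1) = P_i - P_i^2] satisfies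
   [P = \sum_(i < n) P_i^2 + P_n] and [P_i w] gets arbitrarily small. *)
Lemma psd_mul P B : sym P -> psd P -> psd (fun w => w - P w) ->
  sym B -> psd B -> (forall w, P (B w) = B (P w)) -> psd (fun w => P (B w)).
Proof.
move=> sP P0 P1 sB B0 PB w.
pose Q := fix Q i : V -> V := if i is j.+1 then fun v => Q j v - Q j (Q j v) else P.
have sQ i : sym (Q i).
  elim: i => //= i sQi u v; by rewrite dotBl dotBr sQi sQi sQi.
have QB i v : Q i (B v) = B (Q i v).
  elim: i v => //= i IH v; by rewrite !IH symB.
have [Q0 Q1] : (forall i, psd (Q i)) /\ (forall i, psd (fun v => v - Q i v)).
  suff H i : psd (Q i) /\ psd (fun v => v - Q i v) by split=> i; case: (H i).
  elim: i => [//|i [H0 H1]]; split=> v /=.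
    (* With [q = Q i]: [q - q^2 = (1 - q) q (1 - q) + q (1 - q) q], and below
       [1 - (q - q^2) = (1 - q) + q^2]. *)
    have h0 := H0 (v - Q i v); have h1 := H1 (Q i v).
    by move: h0 h1; rewrite (symB (sQ i)) !dotBl !dotBr; lra.
  have h1 := H1 v; move: h1; rewrite !dotBl (sQ i (Q i v)).
  by have := dot_ge0 (Q i v); lra.
have sumQ n : \sum_(i < n) dot (Q i w) (Q i w) = dot (P w) w - dot (Q n w) w.
  elim: n => [|n IH]; first by rewrite big_ord0 subrr.
  by rewrite big_ord_recr/= IH dotBl (sQ n (Q n w)); lra.
have sumQB n : dot (P (B w)) w = \sum_(i < n) dot (B (Q i w)) (Q i w) + dot (B w) (Q n w).
  elim: n => [|n IH]; first by rewrite big_ord0 add0r sP.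
  rewrite big_ord_recr/= IH dotBr -QB sQ; lra.
apply/ler_addgt0Pl => e e0; rewrite addrC.
(* Otherwise Cauchy's inequality keeps every [|Q n w|^2] above a fixed multiple of [e^2], while
   their partial sums stay below [dot (P w) w]; this contradicts the Archimedean property. *)
have [n hn] : exists n, 0 <= dot (B w) (Q n w) + e.
  apply: contrapT => /forallNP H.
  have {}H n : e < - dot (B w) (Q n w).
    rewrite ltNge; apply/negP => h; apply: (H n); lra.
  have {}H n : e ^+ 2 <= dot (B w) (B w) * dot (Q n w) (Q n w).
    apply: le_trans (dot_cauchy _ _).
    by rewrite -[leRHS]sqrrN ler_sqr ?nnegrE ?(ltW (H n)) ?ltW// (lt_trans e0 (H n)).
  have H' n : n%:R * e ^+ 2 <= dot (B w) (B w) * dot (P w) w.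
    apply: (@le_trans _ _ (dot (B w) (B w) * \sum_(i < n) dot (Q i w) (Q i w))).
      rewrite mulr_sumr -[n in n%:R]card_ord -sumr_const mulr_suml.
      by apply: ler_sum => i _; rewrite mul1r.
    by rewrite sumQ ler_wpM2l ?dot_ge0// gerBl Q0.
  set K := dot (B w) (B w) * dot (P w) w in H'.
  have e2 : 0 < e ^+ 2 by rewrite exprn_gt0.
  have K0 : 0 <= K / e ^+ 2.
    by rewrite divr_ge0 ?(ltW e2)// (le_trans _ (H' 0%N))// mul0r.
  have := archi_boundP K0; rewrite ltNge => /negP; apply.
  by rewrite ler_pdivlMr.
rewrite (sumQB n) -addrA addr_ge0//; by apply: sumr_ge0 => i _; exact: B0.
Qed.

(** [|P w|^2 <= (P w, w) <= |w|^2]; the first inequality is [psd_mul] for the commuting factors [P]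
    and [I - P]. *)
Lemma sym_contraction P : sym P -> psd P -> psd (fun w => w - P w) ->
  forall w, nrm (P w) <= nrm w.
Proof.
move=> sP P0 P1 w; rewrite ler_sqrt ?dot_ge0//.
have sQ : sym (fun v => v - P v) by move=> u v; rewrite dotBl dotBr sP.
have h := @psd_mul P (fun v => v - P v) sP P0 P1 sQ P1 (fun v => symB sP _ _) w.
by move: h (P1 w); rewrite symB// !dotBl (sP (P w)); lra.
Qed.

(** Coercivity makes the kernel trivial, and in finite dimension this is invertibility. *)
Lemma sym_inverse F (c : R) : sym F -> 0 < c -> psd (fun w => F w - c *: w) ->
  exists G, [/\ cancel F G, cancel G F & sym G].
Proof.
move=> sF c0 Fc.
pose flM := GRing.isLinear.Build _ _ _ _ F (sym_linear sF).
pose fL : {linear V -> V} := HB.pack F flM.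
have kF w : F w = 0 -> w = 0.
  move=> Fw; apply: dot_eq0; apply/eqP; rewrite eq_le dot_ge0 andbT.
  by have := Fc w; rewrite Fw sub0r dotNl dotZl oppr_ge0 pmulr_rle0.
have k0 : lker (linfun fL) == 0%VS.
  apply/eqP/vspaceP => w; rewrite memv_ker memv0 lfunE/=.
  by apply/eqP/eqP => [/kF //|->]; rewrite sym0.
pose G : V -> V := ((linfun fL)^-1)%VF.
have FK : cancel F G by move=> w; rewrite -[F w](lfunE fL) /G lker0_lfunK.
have GK : cancel G F by move=> w; rewrite -[LHS](lfunE fL) /G lker0_lfunVK.
by exists G; split=> // v w; rewrite -{2}(GK v) sF GK.
Qed.


(** [D] stands for [- L_h]. Pairing the recurrence with [r m.+2 - r m] telescopes the energy: [E
    m.+1 - E m = ht (Psi m.+1, d m.+1 + d m)]. As [|d m| <= sqrt (E m) / eps0], each step raises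
    [sqrt E] by at most [ht c / eps0], so growth is linear in time. Differences are indexed by their
    left end. *)
Lemma energy_bound (A D : V -> V) (r Psi : nat -> V) (M : nat) (ht eps eps0 c : R) :
  0 < ht -> 0 <= eps -> 0 < eps0 -> 0 <= c -> sym A -> psd D ->
  (forall w, eps * dot (D w) w <= dot (A w) w) ->
  (forall m, (m < M)%N ->
     ht ^+ 2 / 4 * dot (A (r m.+1 - r m)) (r m.+1 - r m) <=
     (1 - eps0 ^+ 2) * dot (r m.+1 - r m) (r m.+1 - r m)) ->
  r 0%N = 0 -> r 1%N = ht *: Psi 0%N ->
  (forall m, (0 < m < M)%N ->
     r m.+1 - r m - (r m - r m.-1) = ht ^+ 2 *: (Psi m - A (r m))) ->
  (forall m, (m < M)%N -> nrm (Psi m) <= c) ->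
  forall m, (m < M)%N ->
  eps0 ^+ 2 * dot (ht^-1 *: (r m.+1 - r m)) (ht^-1 *: (r m.+1 - r m)) +
  eps * dot (D (2^-1 *: (r m + r m.+1))) (2^-1 *: (r m + r m.+1)) <=
  (c + m%:R * (ht * c / eps0)) ^+ 2.
Proof.
move=> ht0 eps_ge0 eps0_gt0 c0 sA D0 AD rA r0 r1 rS Psic.
have htN0 : ht != 0 by rewrite gt_eqF.
pose d m := ht^-1 *: (r m.+1 - r m); pose s m := 2^-1 *: (r m + r m.+1).
pose E m := dot (d m) (d m) + dot (A (r m)) (r m.+1).
have Elow m : (m < M)%N ->
    eps0 ^+ 2 * dot (d m) (d m) + eps * dot (D (s m)) (s m) <= E m.
  move=> mM; rewrite /E.
  have -> : dot (A (r m)) (r m.+1) = dot (A (s m)) (s m) -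
      4^-1 * dot (A (r m.+1 - r m)) (r m.+1 - r m).
    rewrite (symZ sA) (symD sA) (symB sA) !dotE (sA (r m.+1)) (dotC (r m.+1)).
    by field.
  have H1 := rA m mM; have H2 := AD (s m).
  have -> : dot (d m) (d m) = ht^-1 ^+ 2 * dot (r m.+1 - r m) (r m.+1 - r m).
    by rewrite dotZl dotZr; field.
  have : ht^-1 ^+ 2 * (ht ^+ 2 / 4 * dot (A (r m.+1 - r m)) (r m.+1 - r m)) <=
    ht^-1 ^+ 2 * ((1 - eps0 ^+ 2) * dot (r m.+1 - r m) (r m.+1 - r m)).
    by rewrite ler_wpM2l// sqr_ge0.
  have -> : ht^-1 ^+ 2 * (ht ^+ 2 / 4 * dot (A (r m.+1 - r m)) (r m.+1 - r m)) =
    4^-1 * dot (A (r m.+1 - r m)) (r m.+1 - r m) by field.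
  by nra.
have E_ge0 m : (m < M)%N -> 0 <= E m.
  move=> mM; apply: le_trans (Elow m mM).
  by rewrite addr_ge0// mulr_ge0// ?sqr_ge0 ?dot_ge0 ?D0.
have dE m : (m < M)%N -> nrm (d m) <= Num.sqrt (E m) / eps0.
  move=> mM; rewrite ler_pdivlMr// -ler_sqr ?nnegrE ?sqrtr_ge0//; last first.
    by rewrite mulr_ge0 ?nrm_ge0 ?(ltW eps0_gt0).
  rewrite sqr_sqrtr ?E_ge0// exprMn sqr_nrm mulrC; apply: le_trans (Elow m mM).
  by rewrite lerDl mulr_ge0// D0.
have EB m : (m < M)%N -> Num.sqrt (E m) <= c + m%:R * (ht * c / eps0).
  elim: m => [|m IH] mM.
    (* Since [r 0] vanishes, the initial energy is just [|Psi 0|^2]. *)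
    rewrite mul0r addr0 -[leRHS]ger0_norm// -sqrtr_sqr ler_sqrt ?sqr_ge0//.
    rewrite /E r0 sym0// dot0l addr0 /d r0 subr0 r1 scalerA mulVf// scale1r.
    by rewrite -sqr_nrm ler_sqr ?nnegrE ?nrm_ge0// Psic.
  have {}IH := IH (ltnW mM).
  have step : E m.+1 - E m = ht * dot (Psi m.+1) (d m.+1 + d m).
    have e := rS m.+1 mM; rewrite /= in e.
    have e' : d m.+1 - d m = ht *: (Psi m.+1 - A (r m.+1)).
      rewrite /d -scalerBr e scalerA; congr (_ *: _); by field.
    have -> : Psi m.+1 = ht^-1 *: (d m.+1 - d m) + A (r m.+1).
      by rewrite e' scalerA mulVf// scale1r subrK.
    have e2 : r m.+2 - r m = ht *: (d m.+1 + d m).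
      by rewrite /d -scalerDr scalerA mulfV// scale1r addrA subrK.
    have e3 : dot (A (r m.+1)) (r m.+2) - dot (A (r m)) (r m.+1) =
        ht * dot (A (r m.+1)) (d m.+1 + d m).
      by rewrite -dotZr -e2 dotBr (sA (r m)) (dotC (r m)).
    rewrite /E; move: htN0 e3; clear => htN0; move: (d m.+1) (d m) => p q.
    rewrite !dotE (dotC q p) => e3.
    have -> : forall a b x y : R, a + x - (b + y) = a - b + (x - y) by move=> *; ring.
    rewrite e3; by field.
  have hs : E m.+1 - E m <= ht * c / eps0 * (Num.sqrt (E m.+1) + Num.sqrt (E m)).
    rewrite step -!mulrA ler_pM2l//.
    apply: le_trans (dot_le_nrm _ _) _.
    apply: ler_pM; rewrite ?nrm_ge0 ?Psic//.
    apply: le_trans (nrmD _ _) _; rewrite mulrC mulrDl.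
    by apply: lerD; [exact: dE|apply: dE; exact: ltnW].
  have s1 := sqr_sqrtr (E_ge0 _ mM); have s0 := sqr_sqrtr (E_ge0 _ (ltnW mM)).
  have p1 := sqrtr_ge0 (E m.+1); have p0 := sqrtr_ge0 (E m).
  set x := Num.sqrt (E m.+1) in s1 p1 hs *; set y := Num.sqrt (E m) in s0 p0 hs IH *.
  set k := ht * c / eps0 in hs IH *.
  have k0 : 0 <= k by rewrite !mulr_ge0// ?invr_ge0 ltW.
  (* [x^2 - y^2 <= k (x + y)] is divided by [x + y], which is positive if the claim fails. *)
  have xy : x <= y + k.
    rewrite leNgt; apply/negP => lt.
    have xy0 : 0 < x + y by lra.
    have : (x - y - k) * (x + y) <= 0 by rewrite -s1 -s0 in hs; nra.
    by rewrite pmulr_lle0//; lra.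
  by rewrite -natr1 mulrDl mul1r; lra.
move=> m mM; apply: le_trans (Elow m mM) _.
rewrite -(sqr_sqrtr (E_ge0 m mM)).
apply: lerXn2r; rewrite ?nnegrE ?sqrtr_ge0 ?EB//.
exact: le_trans (sqrtr_ge0 _) (EB m mM).
Qed.

End SymmetricOperators.

(** * Neighbour maps on the grid of multi-indices *)

Section MeshNeighbours.
Variables (n : nat) (N : 'I_n -> nat).
Implicit Types (l : grid N) (k j : 'I_n).

Lemma omegaP l : reflect (forall k, (0 < l k < N k)%N) (l \in omega_h N).
Proof. by rewrite inE; exact: forallP. Qed.

Lemma next_nodeE k l : (l k < N k)%N -> next_node k l k = (l k).+1 :> nat.
Proof. by move=> lN; rewrite ffunE eqxx inordK. Qed.

Lemma next_node_last k l : l k = N k :> nat -> next_node k l k = 0%N :> nat.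
Proof. by move=> lN; rewrite ffunE eqxx /inord val_insubd lN ltnn. Qed.

Lemma prev_nodeE k l : prev_node k l k = (l k).-1 :> nat.
Proof. by rewrite ffunE eqxx inordK// (leq_ltn_trans (leq_pred _) (ltn_ord _)). Qed.

Lemma next_node_neq k j l : j != k -> next_node k l j = l j.
Proof. by move=> /negbTE jk; rewrite ffunE jk. Qed.

Lemma prev_node_neq k j l : j != k -> prev_node k l j = l j.
Proof. by move=> /negbTE jk; rewrite ffunE jk. Qed.

Lemma grid_eqP k l l' : l k = l' k :> nat -> (forall j, j != k -> l j = l' j) -> l = l'.
Proof.
move=> ek e; apply/ffunP => j; have [->|/e//] := eqVneq j k; exact: val_inj.
Qed.

(* [next_node] is cyclic on the closed mesh: [inord] sends [N k + 1] to 0. *)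
Lemma next_node_inj k : injective (next_node (N := N) k).
Proof.
move=> l l' e; apply: (@grid_eqP k) => [|j jk]; last first.
  by have := congr1 (fun z : grid N => z j) e; rewrite !next_node_neq.
have := congr1 (fun z : grid N => nat_of_ord (z k)) e.
have := ltn_ord (l k); have := ltn_ord (l' k); rewrite !ltnS.
rewrite leq_eqVlt => /predU1P[E'|E']; rewrite leq_eqVlt => /predU1P[E|E].
- by rewrite E E'.
- by rewrite next_nodeE// next_node_last.
- by rewrite next_node_last// next_nodeE.
- by rewrite !next_nodeE// => -[].
Qed.

(** [next_node] wraps around while [prev_node] stops at index 0, so the last node has to be
    excluded. *)
Lemma next_nodeK k l : (l k < N k)%N -> prev_node k (next_node k l) = l.
Proof.
move=> lN; apply: (@grid_eqP k) => [|j jk]; first by rewrite prev_nodeE next_nodeE.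
by rewrite prev_node_neq// next_node_neq.
Qed.

Lemma next_nodeC k j l : j != k ->
  next_node j (next_node k l) = next_node k (next_node j l).
Proof.
by move=> jk; apply/ffunP => i; rewrite !ffunE; case: (eqVneq i j) => [->|];
  rewrite ?(negbTE jk).
Qed.

Lemma next_prev_nodeC k j l : j != k ->
  next_node j (prev_node k l) = prev_node k (next_node j l).
Proof.
by move=> jk; apply/ffunP => i; rewrite !ffunE; case: (eqVneq i j) => [->|];
  rewrite ?(negbTE jk).
Qed.

Lemma prev_nodeC k j l : j != k ->
  prev_node j (prev_node k l) = prev_node k (prev_node j l).
Proof.
by move=> jk; apply/ffunP => i; rewrite !ffunE; case: (eqVneq i j) => [->|];
  rewrite ?(negbTE jk).
Qed.

End MeshNeighbours.

(** * Second differences, the Numerov averages and their inverses as symmetric operators *)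

Section MeshOperators.
Variables (R : realType) (n : nat) (N : 'I_n -> nat) (h : 'I_n -> R).
Hypothesis h_gt0 : forall k, 0 < h k.
Local Notation V := {ffun grid N -> R}.
Implicit Types (l : grid N) (k j : 'I_n) (v w z : V).

Definition inner_part w : V := [ffun l => if l \in omega_h N then w l else 0].
Local Notation J := inner_part.

Lemma inner_partHh w : Hh (J w).
Proof. by move=> l; rewrite finset.in_setC ffunE => /negbTE ->. Qed.

Lemma inner_part_id w : Hh w -> J w = w.
Proof.
move=> Hw; apply/ffunP => l; rewrite ffunE; case: ifPn => // lN.
by rewrite Hw// finset.in_setC.
Qed.

Lemma dot_inner_part v w : dot (J v) w = dot v (J w).
Proof.
by apply: eq_bigr => l _; rewrite !ffunE; case: ifP => _; rewrite ?mul0r ?mulr0.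
Qed.

Lemma nrm_inner_part w : nrm (J w) <= nrm w.
Proof.
rewrite ler_sqrt ?dot_ge0//; apply: ler_sum => l _; rewrite ffunE.
by case: ifP => _//; rewrite mulr0 -expr2 sqr_ge0.
Qed.

Lemma inner_hE v w : Hh w -> inner_h h v w = (\prod_(k < n) h k) * dot v w.
Proof.
move=> Hw; congr (_ * _); rewrite [RHS](bigID (mem (omega_h N)))/=.
rewrite [X in _ = _ + X]big1 ?addr0// => l lN; rewrite Hw ?mulr0// finset.in_setC.
exact: lN.
Qed.

(* Precomposed with [inner_part], the operators are symmetric and commute on all
   mesh functions, and not only on [Hh]. *)
Definition Lam0 k w : V := Lam h k (J w).

Lemma Lam_Hh k w : Hh (Lam h k w).
Proof. by move=> l; rewrite finset.in_setC ffunE => /negbTE ->. Qed.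

Lemma Lam0_inner_part k w : Lam0 k (J w) = Lam0 k w.
Proof. by rewrite /Lam0 (inner_part_id (@inner_partHh w)). Qed.

Lemma inner_part_Lam0 k w : J (Lam0 k w) = Lam0 k w.
Proof. exact/inner_part_id/Lam_Hh. Qed.

Let shift k v w := \sum_l J v (next_node k l) * J w l.

(** Summation by parts as a reindexing by the cyclic shift: no boundary term arises, because where
    the shift wraps it lands at index 0 in direction [k], and [J w] vanishes there. *)
Lemma shift_prev k v w : \sum_l J v (prev_node k l) * J w l = shift k w v.
Proof.
rewrite (reindex_inj (@next_node_inj _ _ k)); apply: eq_bigr => l _.
have := ltn_ord (l k); rewrite ltnS leq_eqVlt => /predU1P[lN|lN].
  rewrite [J w _]ffunE; case: omegaP => [/(_ k)|_]; rewrite ?mul0r ?mulr0//.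
  by rewrite next_node_last.
by rewrite next_nodeK// mulrC.
Qed.

(** [|x y| <= (x^2 + y^2) / 2] term by term; the cyclic shift preserves the sum of squares. *)
Lemma shift_bound k w : `|shift k w w| <= dot w w.
Proof.
apply: (@le_trans _ _ (dot (J w) (J w))); last first.
  by rewrite -!sqr_nrm ler_sqr ?nnegrE ?nrm_ge0// nrm_inner_part.
have e : dot (J w) (J w) = \sum_l J w (next_node k l) ^+ 2.
  by rewrite /dot (reindex_inj (@next_node_inj _ _ k)).
have -> : dot (J w) (J w) = \sum_l (J w (next_node k l) ^+ 2 + J w l ^+ 2) / 2.
  rewrite -mulr_suml big_split -e /=.
  rewrite [X in _ + X](_ : _ = dot (J w) (J w)) //; by field.
apply: le_trans (ler_norm_sum _ _ _) _; apply: ler_sum => l _.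
set x := J w _; set y := J w _; rewrite ler_norml; apply/andP; split.
  by have := sqr_ge0 (x + y); lra.
by have := sqr_ge0 (x - y); lra.
Qed.

Lemma dot_Lam0 k v w :
  dot (Lam0 k v) w = (shift k v w - 2 * dot (J v) (J w) + shift k w v) / h k ^+ 2.
Proof.
rewrite -(shift_prev k v w) /shift /dot mulr_sumr -sumrN -!big_split mulr_suml.
apply: eq_bigr => l _; rewrite /= [Lam0 _ _ _]ffunE !(ffunE _ l).
by case: ifPn => lN; rewrite ?lN; ring.
Qed.

Lemma sym_Lam0 k : sym (Lam0 k).
Proof. by move=> v w; rewrite (dotC v) !dot_Lam0 (dotC (J v)); ring. Qed.

Lemma Lam0_le0 k w : dot (Lam0 k w) w <= 0.
Proof.
(* [shift_bound] has [dot w w] on the right, but the diagonal term to be matched is that of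
   [J w]. *)
have -> : dot (Lam0 k w) w = dot (Lam0 k (J w)) (J w).
  by rewrite -dot_inner_part inner_part_Lam0 Lam0_inner_part.
rewrite dot_Lam0 (inner_part_id (@inner_partHh w)).
rewrite mulr_le0_ge0 ?invr_ge0 ?sqr_ge0//.
by have := shift_bound k (J w); rewrite ler_norml; lra.
Qed.

Lemma Lam0_ge k w : - (4 / h k ^+ 2) * dot w w <= dot (Lam0 k w) w.
Proof.
rewrite dot_Lam0 mulNr mulrAC -mulNr ler_wpM2r ?invr_ge0 ?sqr_ge0//.
have := shift_bound k w; rewrite ler_norml.
have : dot (J w) (J w) <= dot w w.
  by rewrite -!sqr_nrm ler_sqr ?nnegrE ?nrm_ge0// nrm_inner_part.
by lra.
Qed.

(** Beyond [omega_h] this covers nodes that are extremal in another direction [j]: there all three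
    values of [J w] vanish. Commutation needs such nodes, as neighbours of interior ones. *)
Lemma Lam0_formula k w l : (0 < l k < N k)%N ->
  Lam0 k w l = (J w (next_node k l) - 2 * J w l + J w (prev_node k l)) / h k ^+ 2.
Proof.
move=> lk; rewrite [LHS]ffunE; case: ifPn => // /omegaP lN.
have [j jlN] : exists j, ~ (0 < l j < N j)%N by exact/existsNP.
have jk : j != k by apply/eqP => jk; apply: jlN; rewrite jk.
have J0 l' : l' j = l j -> J w l' = 0.
  by move=> e; rewrite ffunE; case: omegaP => // /(_ j); rewrite e.
by rewrite !J0 ?next_node_neq ?prev_node_neq//; ring.
Qed.

Lemma Lam0C k j w : Lam0 k (Lam0 j w) = Lam0 j (Lam0 k w).
Proof.
have [->//|kj] := eqVneq k j; have jk : j != k by rewrite eq_sym.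
apply/ffunP => l; have [/omegaP lN|lN] := boolP (l \in omega_h N); last first.
  by rewrite !Lam_Hh// finset.in_setC.
rewrite !(@Lam0_formula _ _ l)// !inner_part_Lam0.
rewrite !(@Lam0_formula j)// ?next_node_neq ?prev_node_neq//.
rewrite !(@Lam0_formula k)// ?next_node_neq ?prev_node_neq//.
rewrite !(next_nodeC _ jk) !(prev_nodeC _ jk) !(next_prev_nodeC _ jk).
by rewrite !(next_prev_nodeC _ kj); ring.
Qed.

Let cN k := h k ^+ 2 / 12.

(** [sN] annihilates boundary values and so is singular on the space of all mesh functions; [sN0] is
    the identity at boundary nodes and hence coercive on the whole space. *)
Definition sN0 k w : V := w + cN k *: Lam0 k w.

Lemma sN0E k w : Hh w -> sN k w = sN0 k w.
Proof.
move=> Hw; rewrite /sN0 /Lam0 inner_part_id//; apply/ffunP => l; rewrite !ffunE.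
case: ifPn => lN.
  have := h_gt0 k; rewrite /GRing.scale/= /cN; move: (h k) => x x0.
  by field; rewrite gt_eqF.
by rewrite Hw ?finset.in_setC// scaler0 addr0.
Qed.

Lemma sym_sN0 k : sym (sN0 k).
Proof. by move=> v w; rewrite !dotE sym_Lam0. Qed.

(** [2/3 = 1 - 4/12], by the lower bound [- 4 / h_k^2] of [Lam0]. *)
Lemma sN0_ge k w : 2 / 3 * dot w w <= dot (sN0 k w) w.
Proof.
have h2 : 0 < h k ^+ 2 by rewrite exprn_gt0.
rewrite !dotE; have : cN k * (- (4 / h k ^+ 2) * dot w w) <= cN k * dot (Lam0 k w) w.
  by rewrite ler_wpM2l ?Lam0_ge// /cN; lra.
have -> : cN k * (- (4 / h k ^+ 2) * dot w w) = - (1 / 3) * dot w w.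
  by rewrite /cN; field; rewrite gt_eqF.
by lra.
Qed.

Lemma sN0C k j w : sN0 k (Lam0 j w) = Lam0 j (sN0 k w).
Proof.
by rewrite /sN0 (symD (@sym_Lam0 j)) (symZ (@sym_Lam0 j)) Lam0C.
Qed.

Lemma sN0_inj k : injective (sN0 k).
Proof.
have [|w|G [GK _ _]] := @sym_inverse R _ (sN0 k) (2 / 3) (@sym_sN0 k).
- by lra.
- by rewrite dotBl dotZl subr_ge0 sN0_ge.
exact: can_inj GK.
Qed.

Definition tN k w : V := sN_inv k (J w).

(** The choice in [sN_inv] never falls back on its default: the inverse of [sN0] at [J w] is a
    solution, and it lies in [Hh] because [sN0] is the identity on boundary nodes. *)
Lemma tN_spec k w : Hh (tN k w) /\ sN0 k (tN k w) = J w.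
Proof.
have [|v|G [_ GK _]] := @sym_inverse R _ (sN0 k) (2 / 3) (@sym_sN0 k).
- by lra.
- by rewrite dotBl dotZl subr_ge0 sN0_ge.
suff: Hh (tN k w) /\ sN k (tN k w) = J w by case=> Ht; rewrite sN0E.
rewrite /tN /sN_inv; case: xgetP => [z -> //|/(_ (G (J w)))[]].
have HG : Hh (G (J w)).
  move=> l lb; have := congr1 (fun z : V => z l) (GK (J w)).
  rewrite /sN0 [LHS]ffunE [X in _ + X]ffunE (@Lam_Hh k _ l lb) scaler0 addr0.
  by rewrite (@inner_partHh w l lb).
by split=> //; rewrite sN0E.
Qed.

Lemma tN_Hh k w : Hh (tN k w). Proof. by case: (tN_spec k w). Qed.

Lemma tNK k w : sN0 k (tN k w) = J w. Proof. by case: (tN_spec k w). Qed.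

Lemma tN_uniq k w z : sN0 k z = J w -> tN k w = z.
Proof. by move=> e; apply: (@sN0_inj k); rewrite tNK. Qed.

Lemma sym_tN k : sym (tN k).
Proof.
move=> v w; rewrite -(inner_part_id (@tN_Hh k v)) dot_inner_part -(tNK k w).
by rewrite -sym_sN0 tNK dot_inner_part inner_part_id//; exact: tN_Hh.
Qed.

Lemma tN_Lam0 k j w : tN k (Lam0 j w) = Lam0 j (tN k w).
Proof. by apply: tN_uniq; rewrite sN0C tNK Lam0_inner_part inner_part_Lam0. Qed.

Lemma nrm_tN k w : nrm (tN k w) <= 3 / 2 * nrm w.
Proof.
have := sN0_ge k (tN k w); rewrite tNK => H.
have := le_trans H (dot_le_nrm _ _); rewrite -sqr_nrm => {}H.
have : 2 / 3 * nrm (tN k w) ^+ 2 <= nrm w * nrm (tN k w).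
  by apply: le_trans H _; rewrite ler_wpM2r ?nrm_ge0 ?nrm_inner_part.
have := nrm_ge0 (tN k w); rewrite le_eqVlt => /predU1P[<- _|t0].
  by have := nrm_ge0 w; lra.
by rewrite expr2 mulrA ler_pM2r//; lra.
Qed.

(* With [y = s^-1 w] the difference of the two sides is
   [h^2/12 (s (Lambda y), Lambda y)]. *)
Lemma tN_Lam0_le k w : dot (tN k (Lam0 k w)) w <= dot (Lam0 k w) w.
Proof.
rewrite tN_Lam0 -subr_ge0 -dotBl; set y := tN k w.
have -> : Lam0 k w = Lam0 k y + cN k *: Lam0 k (Lam0 k y).
  by rewrite -(Lam0_inner_part k w) -(tNK k w) -/y -sN0C.
rewrite addrC addKr dotZl mulr_ge0 1?sym_Lam0//.
  by rewrite divr_ge0 ?sqr_ge0//; lra.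
rewrite -(Lam0_inner_part k w) -(tNK k w) -/y -sN0C dotC.
by apply: le_trans (sN0_ge _ _); rewrite mulr_ge0 ?dot_ge0//; lra.
Qed.

(** * The operators [L_h], [I + h_t^2/12 L_h] and [A_h] under the first mesh condition *)

Variables (a : 'I_n -> R) (ht eps : R).
Hypothesis eps_ge0 : 0 <= eps.
Hypothesis cfl : ht ^+ 2 / 3 * (\sum_(k < n) a k ^+ 2 / h k ^+ 2) <= 1 - eps.

Definition Lh0 w : V := \sum_k a k ^+ 2 *: Lam0 k w.

Lemma Lh0E w : Hh w -> Lh a h w = Lh0 w.
Proof.
move=> Hw; apply/ffunP => l; rewrite ffunE sum_ffunE; apply: eq_bigr => k _.
by rewrite [in RHS]ffunE /Lam0 inner_part_id.
Qed.

Lemma sym_Lh0 : sym Lh0.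
Proof.
move=> v w; rewrite /Lh0 (dotC v) !dot_suml; apply: eq_bigr => k _.
by rewrite !dotE sym_Lam0 (dotC v).
Qed.

Let ct := ht ^+ 2 / 12.

Definition G0 w : V := w + ct *: Lh0 w.

Lemma sym_G0 : sym G0.
Proof. by move=> v w; rewrite !dotE sym_Lh0. Qed.

Lemma ct_ge0 : 0 <= ct. Proof. by rewrite divr_ge0 ?sqr_ge0. Qed.

Lemma dotN_Lh0 w : dot (- Lh0 w) w = - \sum_k a k ^+ 2 * dot (Lam0 k w) w.
Proof. by rewrite /Lh0 dotNl dot_suml; under eq_bigr do rewrite dotZl. Qed.

Lemma psdN_Lh0 : psd (fun w => - Lh0 w).
Proof.
move=> w; rewrite dotN_Lh0 oppr_ge0 sumr_le0// => k _.
by rewrite mulr_ge0_le0 ?sqr_ge0 ?Lam0_le0.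
Qed.

Lemma G0_le w : dot (G0 w) w <= dot w w.
Proof.
rewrite !dotE gerDl mulr_ge0_le0 ?ct_ge0//.
by have := psdN_Lh0 w; rewrite dotNl oppr_ge0.
Qed.

(** Each [Lam0 k] is at least [- 4 / h_k^2], and [4/12 = 1/3] is the constant of the first mesh
    condition. *)
Lemma G0_ge w : eps * dot w w <= dot (G0 w) w.
Proof.
rewrite !dotE /Lh0 dot_suml.
have : ct * (- \sum_k (a k ^+ 2 * (4 / h k ^+ 2 * dot w w))) <=
    ct * (\sum_k dot (a k ^+ 2 *: Lam0 k w) w).
  rewrite ler_wpM2l ?ct_ge0// -sumrN; apply: ler_sum => k _.
  by rewrite dotZl -mulrN -mulNr ler_wpM2l ?sqr_ge0 ?Lam0_ge.
have -> : ct * (- \sum_k (a k ^+ 2 * (4 / h k ^+ 2 * dot w w))) =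
    - (ht ^+ 2 / 3 * \sum_k a k ^+ 2 / h k ^+ 2) * dot w w.
  rewrite mulrN mulNr; congr (- _); move: (dot w w) => D.
  rewrite !mulr_sumr mulr_suml.
  by apply: eq_bigr => k _; rewrite /ct; field; rewrite gt_eqF.
have := ler_wpM2r (dot_ge0 w) cfl; lra.
Qed.

Definition B0 w : V := - \sum_k a k ^+ 2 *: tN k (Lam0 k w).

Lemma sym_B0 : sym B0.
Proof.
move=> v w; rewrite /B0 dotNl dotNr; congr (- _); rewrite (dotC v) !dot_suml.
by apply: eq_bigr => k _; rewrite !dotE sym_tN sym_Lam0 -tN_Lam0 (dotC v).
Qed.

Lemma B0_ge w : dot (- Lh0 w) w <= dot (B0 w) w.
Proof.
rewrite /B0 /Lh0 !dotNl lerN2 !dot_suml; apply: ler_sum => k _.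
by rewrite !dotZl ler_wpM2l ?sqr_ge0 ?tN_Lam0_le.
Qed.

Lemma Lh0_Lam0 k w : Lh0 (Lam0 k w) = Lam0 k (Lh0 w).
Proof.
rewrite /Lh0 (sym_sum _ (@sym_Lam0 k)); apply: eq_bigr => j _.
by rewrite (symZ (@sym_Lam0 k)) Lam0C.
Qed.

Lemma Lh0_tN k w : Lh0 (tN k w) = tN k (Lh0 w).
Proof.
rewrite /Lh0 (sym_sum _ (@sym_tN k)); apply: eq_bigr => j _.
by rewrite (symZ (@sym_tN k)) tN_Lam0.
Qed.

Lemma Lh0_B0 w : Lh0 (B0 w) = B0 (Lh0 w).
Proof.
rewrite /B0 (symN sym_Lh0) (sym_sum _ sym_Lh0).
congr (- _); apply: eq_bigr => k _.
by rewrite (symZ sym_Lh0) Lh0_tN Lh0_Lam0.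
Qed.

Lemma G0_B0 w : G0 (B0 w) = B0 (G0 w).
Proof. by rewrite /G0 Lh0_B0 (symD sym_B0) (symZ sym_B0). Qed.

Definition A0 w : V := G0 (B0 w).

Lemma sym_A0 : sym A0.
Proof. by move=> v w; rewrite sym_G0 sym_B0 -G0_B0. Qed.

Lemma psd_B0 : psd B0.
Proof. by move=> w; apply: le_trans (B0_ge w); exact: psdN_Lh0. Qed.

Lemma A0_ge w : eps * dot (- Lh0 w) w <= dot (A0 w) w.
Proof.
apply: (@le_trans _ _ (eps * dot (B0 w) w)); first by rewrite ler_wpM2l ?B0_ge.
(* [psd_mul] wants a factor between 0 and [I]; for [G0 - eps I] its conclusion is exactly
   [A0 >= eps B0]. *)
pose P v := G0 v - eps *: v.
have sP : sym P by move=> u v; rewrite dotBl dotBr dotZl dotZr sym_G0.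
have := @psd_mul R _ P B0 sP _ _ sym_B0 psd_B0 _ w.
rewrite [P (B0 w)]/P dotBl dotZl subr_ge0; apply.
- by move=> v; rewrite dotBl dotZl subr_ge0 G0_ge.
- move=> v; have := mulr_ge0 eps_ge0 (dot_ge0 v).
  by rewrite /P !dotBl dotZl; have := G0_le v; lra.
- by move=> v; rewrite /P G0_B0 (symB sym_B0) (symZ sym_B0).
Qed.

Lemma nrm_G0 w : nrm (G0 w) <= nrm w.
Proof.
apply: sym_contraction => [|v|v]; first exact: sym_G0.
  by apply: le_trans (G0_ge v); rewrite mulr_ge0 ?dot_ge0.
by rewrite dotBl subr_ge0 G0_le.
Qed.

Lemma I_plus_LhE w : Hh w -> I_plus_Lh a h ct w = G0 w.
Proof.
move=> Hw; rewrite /I_plus_Lh Lh0E//; apply/ffunP => l; rewrite /G0 ffunE [RHS]ffunE; congr (_ + _).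
by rewrite [RHS]ffunE.
Qed.

Lemma B0_Hh w : Hh (B0 w).
Proof.
move=> l lb; rewrite ffunE sum_ffunE big1 ?oppr0// => k _.
by rewrite ffunE tN_Hh// scaler0.
Qed.

Lemma AhE w : Hh w -> Ah a h ht w = A0 w.
Proof.
move=> Hw; rewrite /Ah; set z := finfun _.
have -> : z = B0 w.
  apply/ffunP => l; rewrite !ffunE sum_ffunE; congr (- _); apply: eq_bigr => k _.
  by rewrite [in RHS]ffunE /tN inner_part_Lam0 /Lam0 inner_part_id.
by rewrite I_plus_LhE//; exact: B0_Hh.
Qed.

End MeshOperators.

(** * Calculus on a closed segment with one-sided derivatives at the ends *)

Section OneSidedCalculus.
Variable R : realType.
Implicit Types (X T s t x y d B e : R) (phi psi : R -> R).

Definition seg X : set R := [set s | 0 <= s <= X].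

Definition der X phi s d := diff_quot_on (seg X) phi s --> d.

Lemma derP X phi s d : der X phi s d <->
  forall e, 0 < e -> exists2 del, 0 < del & forall r, seg X r -> r != s ->
    `|r - s| < del -> `|d - (phi r - phi s) / (r - s)| < e.
Proof.
split.
  move=> /cvgrPdist_lt H e e0; have := H e e0 => -[del /= del0 H']; exists del => // r rX rs rd.
  by apply: H' => //=; rewrite distrC.
move=> H; apply/cvgrPdist_lt => e e0; have [del del0 H'] := H e e0.
exists del => //= r rd rs rX.
by apply: H'; rewrite // distrC.
Qed.

(** Every point of the segment is an accumulation point of it, which makes the limit in [derive_on]
    unique. *)
Lemma seg_proper X s : 0 < X -> seg X s -> ProperFilter (within (seg X) (s^')).
Proof.
move=> X0 sX; apply: Build_ProperFilter_ex => P [del /= del0 H].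
(* The nearby point is taken on the side of the farther end, so it stays in the segment. *)
pose c := if s < X / 2 then s + Num.min (del / 2) (X / 2)
  else s - Num.min (del / 2) (X / 2).
have m0 : 0 < Num.min (del / 2) (X / 2) by rewrite lt_min !divr_gt0.
have m1 : Num.min (del / 2) (X / 2) <= del / 2 by rewrite ge_min lexx.
have m2 : Num.min (del / 2) (X / 2) <= X / 2 by rewrite ge_min lexx orbT.
move: sX; rewrite /seg/= => /andP[s0 sX].
exists c; apply: H; rewrite /c /=; case: (ltP s (X / 2)) => sX2.
- by rewrite opprD addrA subrr sub0r normrN gtr0_norm//; lra.
- by rewrite opprB addrC subrK gtr0_norm//; lra.
- by rewrite -subr_eq0 addrAC subrr add0r gt_eqF.
- by rewrite -subr_eq0 addrAC subrr add0r oppr_eq0 gt_eqF.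
- by rewrite /seg/=; lra.
- by rewrite /seg/=; lra.
Qed.

Lemma derive_onE X phi s d : 0 < X -> seg X s -> der X phi s d ->
  derive_on (seg X) phi s = d.
Proof.
move=> X0 sX H; have PF := seg_proper X0 sX.
exact: (@cvg_lim R _ _ _ PF _ _ H).
Qed.

Lemma derivable_onE X phi s : derivable_on (seg X) phi s ->
  der X phi s (derive_on (seg X) phi s).
Proof. by []. Qed.

Lemma eq_derive_on X phi psi s : seg X s -> (forall r, seg X r -> phi r = psi r) ->
  derive_on (seg X) phi s = derive_on (seg X) psi s.
Proof.
move=> sX e; rewrite /derive_on; congr (lim _); rewrite eqEsubset; split=> P.
  move=> [del /= del0 H]; exists del => //= r rd rs rX.
  by have := H r rd rs rX; rewrite /= !e.
move=> [del /= del0 H]; exists del => //= r rd rs rX.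
by have := H r rd rs rX; rewrite /= !e.
Qed.

Lemma derD X phi psi s d d' : der X phi s d -> der X psi s d' ->
  der X (fun r => phi r + psi r) s (d + d').
Proof.
move=> H H'; rewrite /der /diff_quot_on.
rewrite (_ : (fun r => _) = (fun r => (phi r - phi s) / (r - s)) \+
  (fun r => (psi r - psi s) / (r - s))); first exact: cvgD.
by apply/funext => r /=; rewrite opprD addrACA mulrDl.
Qed.

Lemma derZ X phi s d c : der X phi s d -> der X (fun r => c * phi r) s (c * d).
Proof.
move=> H; rewrite /der /diff_quot_on.
rewrite (_ : (fun r => _) = (fun r => c * ((phi r - phi s) / (r - s)))).
  by apply: cvgM => //; exact: cvg_cst.
by apply/funext => r /=; rewrite -mulrBr mulrA.
Qed.

Lemma derB X phi psi s d d' : der X phi s d -> der X psi s d' ->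
  der X (fun r => phi r - psi r) s (d - d').
Proof.
move=> H H'; have := derD H (@derZ _ _ _ _ (-1) H'); rewrite mulN1r.
by rewrite (_ : (fun r => _) = (fun r => phi r - psi r))//;
  apply/funext => r; rewrite mulN1r.
Qed.

Lemma der_cst X c s : der X (fun=> c) s 0.
Proof.
apply/derP => e e0; exists 1 => // r _ _ _.
by rewrite subrr mul0r subrr normr0.
Qed.

Lemma der_sum X (I : Type) (r : seq I) (P : pred I) (F : I -> R -> R) (D : I -> R) s :
  (forall i, P i -> der X (F i) s (D i)) ->
  der X (fun t => \sum_(i <- r | P i) F i t) s (\sum_(i <- r | P i) D i).
Proof.
move=> H; elim: r => [|i r IH].
  by rewrite big_nil; under eq_fun do rewrite big_nil; exact: der_cst.
rewrite big_cons; under eq_fun do rewrite big_cons.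
by case: ifP => // Pi; apply: derD => //; exact: H.
Qed.

Lemma der_is_derive X phi s d : 0 < s < X -> der X phi s d -> is_derive s 1 phi d.
Proof.
move=> /andP[s0 sX] /derP H.
suff cv : (fun h => h^-1 *: ((phi \o shift s) (h *: 1) - phi s)) @ 0^' --> d.
  split; first by apply/cvg_ex; exists d.
  by apply/cvg_lim => //.
apply/cvgrPdist_lt => e e0; have [del del0 H'] := H e e0.
have m0 : 0 < Num.min del (Num.min s (X - s)).
  by rewrite !lt_min del0 s0 subr_gt0 sX.
exists (Num.min del (Num.min s (X - s))) => //= r.
rewrite /ball_/= sub0r normrN !lt_min => /and3P[rd rs rX] r0.
have -> : r^-1 *: (phi (r *: 1 + s) - phi s) = (phi (r + s) - phi s) / (r + s - s).
  by rewrite addrK /GRing.scale/= mulr1 mulrC.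
apply: H'; rewrite ?addrK//.
  by move: rs rX; rewrite !ltr_norml /seg/=; lra.
by rewrite -subr_eq0 addrK.
Qed.

Lemma is_derive_der X phi s d : is_derive s 1 phi d -> der X phi s d.
Proof.
move=> [/= cv E]; apply/derP => e e0.
have : (fun h => h^-1 *: ((phi \o shift s) (h *: 1) - phi s)) @ 0^' --> d.
  by rewrite -E.
move=> /cvgrPdist_lt /(_ e e0) [del /= del0 H]; exists del => // r rX rs rd.
have := H (r - s); rewrite /ball_/= sub0r normrN => /(_ rd).
rewrite subr_eq0 => /(_ rs).
by rewrite /GRing.scale/= mulr1 subrK mulrC.
Qed.

Lemma der_continuous X phi s d e : der X phi s d -> 0 < e ->
  exists2 del, 0 < del & forall r, seg X r -> `|r - s| < del -> `|phi s - phi r| < e.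
Proof.
move=> /derP /(_ 1 ltr01)[del del0 H] e0.
(* Within [del] of [s] the difference quotient differs from [d] by less than 1, so [|d| + 1] is a
   slope bound. *)
have d1 : 0 < `|d| + 1 by rewrite ltr_wpDl.
exists (Num.min del (e / (`|d| + 1))); first by rewrite lt_min del0 divr_gt0.
move=> r rX; rewrite lt_min => /andP[rd]; rewrite ltr_pdivlMr// => re.
have [->|rs] := eqVneq r s; first by rewrite subrr normr0.
apply: le_lt_trans re; rewrite distrC.
have rs0 : r - s != 0 by rewrite subr_eq0.
rewrite -[phi r - phi s](divfK rs0) normrM mulrC ler_wpM2l//.
have := H r rX rs rd; set q := _ / _ => h.
have := ler_normB d (d - q); rewrite opprB addrC subrK => /le_trans; apply.
by rewrite lerD2l ltW.
Qed.

Lemma der_MVT_lt X phi phi' x y : x < y -> seg X x -> seg X y ->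
  (forall s, seg X s -> der X phi s (phi' s)) ->
  exists2 z, x < z < y & phi y - phi x = phi' z * (y - x).
Proof.
move=> xy /andP[x0 xX] /andP[y0 yX] H.
have [||z zxy e] := @MVT R phi phi' x y xy.
- move=> z; rewrite in_itv/= => /andP[xz zy].
  by apply: (@der_is_derive X); [lra|apply: H; rewrite /seg/=; lra].
- apply/subspace_continuousP => s; rewrite /= in_itv/= => /andP[xs sy].
  apply/cvgrPdist_lt => e e0.
  have sX : seg X s by rewrite /seg/=; lra.
  have [del del0 H'] := der_continuous (H s sX) e0.
  exists del => //= r rd; rewrite in_itv/= => rxy.
  by apply: H'; [rewrite /seg/=; lra|rewrite distrC].
by exists z => //; rewrite in_itv/= in zxy.
Qed.

Lemma der_MVT X phi phi' x y : seg X x -> seg X y ->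
  (forall s, seg X s -> der X phi s (phi' s)) ->
  exists z, [/\ seg X z, `|z - x| <= `|y - x| & phi y - phi x = phi' z * (y - x)].
Proof.
move=> xX yX H; have [xy|yx|<-] := ltgtP x y.
- have [z zxy e] := der_MVT_lt xy xX yX H; exists z; split=> //.
    by move: xX yX; rewrite /seg/=; lra.
  by rewrite !ger0_norm; lra.
- have [z zxy e] := der_MVT_lt yx yX xX H; exists z; split=> //.
    by move: xX yX; rewrite /seg/=; lra.
  by rewrite !ler0_norm; lra.
  by lra.
- by exists x; split=> //; rewrite !subrr mulr0.
Qed.

(* One mean value step per derivative; the factor [1/K!] is given up. *)
Lemma taylor_poly X K (D : nat -> R -> R) (p : {poly R}) s B :
  seg X s ->
  (forall j t, (j < K)%N -> seg X t -> der X (D j) t (D j.+1 t)) ->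
  (forall j, (j < K)%N -> D j s = (p^`(j)).[s]) ->
  (forall t, seg X t -> `|D K t - (p^`(K)).[t]| <= B) ->
  forall t, seg X t -> `|D 0%N t - p.[t]| <= B * `|t - s| ^+ K.
Proof.
move=> sX; elim: K D p => [|K IH] D p HD Hp HB t tX.
  by rewrite expr0 mulr1 -[p in p.[t]]derivn0; exact: HB.
have IH' := IH (fun j => D j.+1) p^`() (fun j t jK => HD j.+1 t jK).
have {}IH' z : seg X z -> `|D 1%N z - (p^`()).[z]| <= B * `|z - s| ^+ K.
  apply: IH' => [j jK|w wX]; rewrite -derivSn; [exact: Hp|exact: HB].
have [z [zX zs e]] := @der_MVT X (fun t => D 0%N t - p.[t])
  (fun t => D 1%N t - (p^`()).[t]) s t sX tX
  (fun r rX => derB (HD 0%N r isT rX) (is_derive_der X (is_derive_poly p r))).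
rewrite -[leLHS]normr_id; have := Hp 0%N isT; rewrite derivn0 => e0.
move: e; rewrite e0 subrr subr0 => ->; rewrite normr_id normrM exprSr mulrA.
rewrite ler_wpM2r//; apply: le_trans (IH' z zX) _.
have [B0|B0] := leP 0 B; first by rewrite ler_wpM2l// lerXn2r ?nnegrE.
by have := le_trans (normr_ge0 _) (HB s sX); lra.
Qed.

(** The Taylor polynomial matches the derivatives of order below [K] at [s], and its own [K]-th
    derivative is 0. *)
Lemma taylor X K (D : nat -> R -> R) s B :
  seg X s ->
  (forall j t, (j < K)%N -> seg X t -> der X (D j) t (D j.+1 t)) ->
  (forall t, seg X t -> `|D K t| <= B) ->
  forall t, seg X t ->
  `|D 0%N t - \sum_(i < K) D i s / i`!%:R * (t - s) ^+ i| <= B * `|t - s| ^+ K.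
Proof.
move=> sX HD HB t tX.
pose q := \poly_(i < K) (D i s / i`!%:R).
pose p := q \Po ('X - s%:P).
have pj j : p^`(j) = q^`(j) \Po ('X - s%:P).
  elim: j => [|j IH]; first by rewrite !derivn0.
  by rewrite !derivnS IH deriv_comp derivXsubC mulr1.
have pE u : p.[u] = q.[u - s] by rewrite horner_comp hornerXsubC.
have := @taylor_poly X K D p s B sX HD _ _ t tX; rewrite pE horner_poly; apply.
  move=> j jK; rewrite pj horner_comp hornerXsubC subrr horner_coef0 coef_derivn.
  by rewrite addn0 coef_poly jK ffactnn -[RHS]mulr_natr divfK.
move=> u uX; rewrite pj derivn_poly0 ?size_poly// comp_poly0 horner0 subr0.
exact: HB.
Qed.

Definition chain X K (D : nat -> R -> R) B :=
  (forall j t, (j < K)%N -> seg X t -> der X (D j) t (D j.+1 t)) /\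
  (forall t, seg X t -> `|D K t| <= B).

Lemma chain_taylor X K D B s et : chain X K D B -> seg X s -> seg X (s + et) ->
  `|D 0%N (s + et) - \sum_(i < K) D i s / i`!%:R * et ^+ i| <= B * `|et| ^+ K.
Proof.
move=> [HD HB] sX spX; have := taylor sX HD HB spX.
by have -> : s + et - s = et by rewrite addrC addKr.
Qed.

Lemma chainS X K D B : chain X K.+1 D B -> chain X K (fun j => D j.+1) B.
Proof. by move=> [HD HB]; split=> [j t jK tX|t tX]; [exact: HD|exact: HB]. Qed.

Lemma chain_ge0 X K D B s : chain X K D B -> seg X s -> 0 <= B.
Proof. by move=> [_ HB] sX; apply: le_trans (normr_ge0 _) (HB s sX). Qed.

Lemma ler_normD_eq (x y z u v : R) : x = y + z -> `|y| <= u -> `|z| <= v ->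
  `|x| <= u + v.
Proof. by move=> -> yu zv; apply: le_trans (ler_normD _ _) (lerD yu zv). Qed.

Lemma chain_taylor_sym X K D B s et : chain X K D B -> 0 < et ->
  seg X (s - et) -> seg X (s + et) ->
  `|D 0%N (s + et) + D 0%N (s - et) -
    \sum_(i < K) D i s / i`!%:R * (et ^+ i + (- et) ^+ i)| <= 2 * B * et ^+ K.
Proof.
move=> C et0 sm sp; have sX : seg X s by move: sm sp; rewrite /seg/=; lra.
have Hm := chain_taylor C sX sm; have Hp := chain_taylor C sX sp.
rewrite normrN !(gtr0_norm et0) in Hm Hp.
rewrite -mulrA mulr_natl mulr2n; apply: ler_normD_eq Hp Hm.
under eq_bigr do rewrite mulrDr.
by rewrite big_split /= opprD addrACA.
Qed.

Lemma second_difference4 X D B s et : chain X 4 D B -> 0 < et ->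
  seg X (s - et) -> seg X (s + et) ->
  `|(D 0%N (s + et) - 2 * D 0%N s + D 0%N (s - et)) / et ^+ 2 - D 2%N s|
    <= 2 * B * et ^+ 2.
Proof.
move=> C et0 sm sp; have := chain_taylor_sym C et0 sm sp.
rewrite !big_ord_recl !big_ord0 /= /bump /= !add1n !factS fact0 !muln1 => H.
have e2 : 0 < et ^+ 2 by rewrite exprn_gt0.
rewrite -(ler_pM2r e2) -[X in _ * X <= _](gtr0_norm e2) -normrM -[X in _ <= X]mulrA -exprD.
by move: H; apply: le_trans; rewrite le_eqVlt; apply/orP; left; apply/eqP;
  congr `|_|; field; rewrite gt_eqF.
Qed.

Lemma second_difference6 X D B s et : chain X 6 D B -> 0 < et ->
  seg X (s - et) -> seg X (s + et) ->
  `|(D 0%N (s + et) - 2 * D 0%N s + D 0%N (s - et)) / et ^+ 2 -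
    (D 2%N s + et ^+ 2 / 12 * D 4%N s)| <= 2 * B * et ^+ 4.
Proof.
move=> C et0 sm sp; have := chain_taylor_sym C et0 sm sp.
rewrite !big_ord_recl !big_ord0 /= /bump /= !add1n !factS fact0 !muln1 => H.
have e2 : 0 < et ^+ 2 by rewrite exprn_gt0.
rewrite -(ler_pM2r e2) -[X in _ * X <= _](gtr0_norm e2) -normrM -[X in _ <= X]mulrA -exprD.
by move: H; apply: le_trans; rewrite le_eqVlt; apply/orP; left; apply/eqP;
  congr `|_|; field; rewrite gt_eqF.
Qed.

(** Both the weighted average of [D 2] and the second difference of [D 0] equal [D 2 + et^2/12 D 4]
    up to order 4. The constant 3 adds 2 from the difference to 1, which is more than the [2/12]
    from the average. *)
Lemma numerov X D B s et : chain X 6 D B -> 0 < et ->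
  seg X (s - et) -> seg X (s + et) ->
  `|(D 2%N (s - et) + 10 * D 2%N s + D 2%N (s + et)) / 12 -
    (D 0%N (s + et) - 2 * D 0%N s + D 0%N (s - et)) / et ^+ 2| <= 3 * B * et ^+ 4.
Proof.
move=> C et0 sm sp; have H6 := second_difference6 C et0 sm sp.
have := chain_taylor_sym (chainS (chainS C)) et0 sm sp.
rewrite !big_ord_recl !big_ord0 /= /bump /= !add1n !factS fact0 !muln1 => H4.
have B0 := chain_ge0 C sm.
have e4 : 0 <= et ^+ 4 by rewrite exprn_ge0 ?ltW.
have -> : 3 * B * et ^+ 4 = B * et ^+ 4 + 2 * B * et ^+ 4 by ring.
rewrite -normrN in H6; apply: (ler_normD_eq _ _ H6); last first.
  set x := (X in `|X| <= _) in H4.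
  have : `|x / 12| <= B * et ^+ 4.
    have := mulr_ge0 B0 e4.
    by rewrite normrM [`|12^-1|]gtr0_norm//; lra.
  exact.
by field; rewrite gt_eqF.
Qed.

Lemma first_difference X D B et : chain X 5 D B -> 0 < et -> seg X et ->
  `|(D 0%N et - D 0%N 0) / et -
    (D 1%N 0 + et / 2 * D 2%N 0 + et ^+ 2 / 6 * D 3%N 0 + et ^+ 3 / 24 * D 4%N 0)|
  <= B * et ^+ 4.
Proof.
move=> C et0 sp; have s0 : seg X 0 by move: sp; rewrite /seg/=; lra.
have := @chain_taylor X 5 D B 0 et C s0; rewrite add0r => /(_ sp).
rewrite (gtr0_norm et0).
rewrite !big_ord_recl !big_ord0 /= /bump /= !add1n !factS fact0 !muln1 => H.
rewrite -(ler_pM2r et0) -[X in _ * X <= _](gtr0_norm et0) -normrM -[X in _ <= X]mulrA -exprSr.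
by move: H; apply: le_trans; rewrite le_eqVlt; apply/orP; left; apply/eqP;
  congr `|_|; field; rewrite gt_eqF.
Qed.

Lemma other_point X s e : 0 < X -> seg X s -> 0 < e ->
  exists r, [/\ seg X r, r != s & `|r - s| < e].
Proof.
move=> X0 sX e0; have PF := seg_proper X0 sX.
have [|r [r1 r2 r3]] := @filter_ex _ _ PF
  [set r | [/\ seg X r, r != s & `|r - s| < e]]; last by exists r.
by exists e => //= r rd rs rX; split=> //; rewrite distrC.
Qed.

(* Both mixed derivatives are limits of the second difference over small
   rectangles with corner [(x, t)]. *)
Lemma mixed_derivatives X T (phi phi1 phi2 phi12 phi21 : R -> R -> R) x t :
  0 < X -> 0 < T -> seg X x -> seg T t ->
  (forall y s, seg X y -> seg T s -> der X (phi ^~ s) y (phi1 y s)) ->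
  (forall y s, seg X y -> seg T s -> der T (phi y) s (phi2 y s)) ->
  (forall y s, seg X y -> seg T s -> der X (phi2 ^~ s) y (phi12 y s)) ->
  (forall y s, seg X y -> seg T s -> der T (phi1 y) s (phi21 y s)) ->
  (forall e, 0 < e -> exists2 del, 0 < del & forall y s, seg X y -> seg T s ->
     `|y - x| < del -> `|s - t| < del -> `|phi12 x t - phi12 y s| < e) ->
  (forall e, 0 < e -> exists2 del, 0 < del & forall y s, seg X y -> seg T s ->
     `|y - x| < del -> `|s - t| < del -> `|phi21 x t - phi21 y s| < e) ->
  phi12 x t = phi21 x t.
Proof.
move=> X0 T0 xX tT d1 d2 d12 d21 c12 c21; apply/eqP; rewrite -subr_eq0 -normr_le0.
apply/ler_addgt0Pl => e e0; rewrite addr0.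
have e2 : 0 < e / 2 by rewrite divr_gt0.
have [a a0 {}c12] := c12 _ e2; have [b b0 {}c21] := c21 _ e2.
have m0 : 0 < Num.min a b by rewrite lt_min a0.
have [x' [x'X x'x]] := other_point X0 xX m0; rewrite lt_min => /andP[xa xb].
have [t' [t'T t't]] := other_point T0 tT m0; rewrite lt_min => /andP[ta tb].
have [y [yX yx e1]] := @der_MVT X (fun y => phi y t' - phi y t)
  (fun y => phi1 y t' - phi1 y t) x x' xX x'X
  (fun s sX => derB (d1 s t' sX t'T) (d1 s t sX tT)).
have [s [sT st e1']] := @der_MVT T (phi1 y) (phi21 y) t t' tT t'T
  (fun s sT => d21 y s yX sT).
have [s' [s'T s't f1]] := @der_MVT T (fun s => phi x' s - phi x s)
  (fun s => phi2 x' s - phi2 x s) t t' tT t'T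
  (fun s sT => derB (d2 x' s x'X sT) (d2 x s xX sT)).
have [y' [y'X y'x f1']] := @der_MVT X (phi2 ^~ s') (phi12 ^~ s') x x' xX x'X
  (fun y yX => d12 y s' yX s'T).
have E : phi12 y' s' = phi21 y s.
  apply: (@mulIf _ ((x' - x) * (t' - t))); first by rewrite mulf_neq0 ?subr_eq0.
  rewrite mulrA -f1' -f1.
  have -> : phi21 y s * ((x' - x) * (t' - t)) = phi21 y s * (t' - t) * (x' - x) by ring.
  by rewrite -e1' -e1; ring.
have h1 := c12 _ _ y'X s'T (le_lt_trans y'x xa) (le_lt_trans s't ta).
have h2 := c21 _ _ yX sT (le_lt_trans yx xb) (le_lt_trans st tb).
rewrite E in h1; apply: (@le_trans _ _ (e / 2 + e / 2)); last by lra.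
apply: (@ler_normD_eq _ (phi12 x t - phi21 y s) (phi21 y s - phi21 x t)).
- by ring.
- exact: ltW.
- by rewrite distrC ltW.
Qed.

End OneSidedCalculus.

(** * Continuity relative to a set *)

Section WithinContinuity.
Variables (R : realType) (E : pseudoMetricType R).
Implicit Types (A S : set E) (w : E -> R) (p q : E).

Lemma within_continuousP A w : {within A, continuous w} <->
  forall p e, A p -> 0 < e ->
  exists2 d : R, 0 < d & forall q, A q -> ball p d q -> `|w p - w q| < e.
Proof.
rewrite subspace_continuousP; split=> [cw p e Ap e0|cw p Ap].
  have /cvgrPdist_lt/(_ e e0) := cw p Ap.
  by move=> /nbhs_ballP[d /= d0 H]; exists d => // q Aq pq; exact: H pq Aq.
apply/cvgrPdist_lt => e e0; have [d d0 H] := cw p e Ap e0.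
by apply/nbhs_ballP; exists d => // q pq Aq; exact: H.
Qed.

(** Carries the equation and the initial and boundary conditions from the open sets where they are
    posed to the closed faces, where mesh nodes lie. *)
Lemma eq_on_closure A S w1 w2 p :
  {within A, continuous w1} -> {within A, continuous w2} ->
  S `<=` A -> (forall q, S q -> w1 q = w2 q) -> A p ->
  (forall d : R, 0 < d -> exists2 q, S q & ball p d q) -> w1 p = w2 p.
Proof.
move=> /within_continuousP c1 /within_continuousP c2 SA e12 Ap H.
apply/eqP; rewrite -subr_eq0 -normr_le0.
apply/ler_addgt0Pl => e e0; rewrite addr0.
have e2 : 0 < e / 2 by rewrite divr_gt0.
have [d1 d10 H1] := c1 p _ Ap e2; have [d2 d20 H2] := c2 p _ Ap e2.
have [|q Sq pq] := H (Num.min d1 d2); first by rewrite lt_min d10.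
have {}H1 : `|w1 p - w1 q| < e / 2.
  by apply: H1; [exact: SA|apply: le_ball pq; rewrite ge_min lexx].
have {}H2 : `|w2 p - w2 q| < e / 2.
  by apply: H2; [exact: SA|apply: le_ball pq; rewrite ge_min lexx orbT].
apply: (@le_trans _ _ (e / 2 + e / 2)); last by lra.
apply: (@ler_normD_eq _ _ (w1 p - w1 q) (w2 q - w2 p)); last 2 first.
- exact: ltW.
- by rewrite distrC ltW.
- by rewrite (e12 q Sq); ring.
Qed.

Lemma within_continuousB A w1 w2 : {within A, continuous w1} ->
  {within A, continuous w2} -> {within A, continuous (fun p => w1 p - w2 p)}.
Proof. by move=> c1 c2 x; apply: cvgB; [exact: c1|exact: c2]. Qed.

Lemma within_continuous_sum A (I : Type) (r : seq I) (c : I -> R) (w : I -> E -> R) :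
  (forall i, {within A, continuous (w i)}) ->
  {within A, continuous (fun p => \sum_(i <- r) c i * w i p)}.
Proof.
move=> H; elim: r => [|i r IH].
  rewrite (_ : (fun p => \sum_(i <- [::]) c i * w i p) = fun=> 0); first by move=> x; exact: cvg_cst.
  by apply/funext => p; rewrite big_nil.
rewrite (_ : (fun p => \sum_(j <- i :: r) c j * w j p) = fun p => c i * w i p + \sum_(j <- r) c j * w j p);
  last by apply/funext => p; rewrite big_cons.
move=> x; apply: cvgD; last exact: IH.
by apply: cvgM; [exact: cvg_cst|exact: H].
Qed.

End WithinContinuity.

(** * The closed cylinder: lines, density of the open parts, compactness *)

Section Cylinder.
Variables (R : realType) (n : nat) (X : 'I_n -> R) (T : R).
Hypotheses (X_gt0 : forall k, 0 < X k) (T_gt0 : 0 < T).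
Implicit Types (p q : 'rV[R]_n * R) (x : 'rV[R]_n) (i : option 'I_n) (k : 'I_n).

Definition len i : R := if i is Some k then X k else T.

Definition upd i p (y : R) : 'rV[R]_n * R :=
  if i is Some k then (set_coord p.1 k y, p.2) else (p.1, y).

Lemma set_coord_set x k (y z : R) :
  set_coord (set_coord x k y) k z = set_coord x k z.
Proof. by apply/rowP => j; rewrite !mxE; case: (j == k). Qed.

Lemma set_coord_id x k : set_coord x k (x 0 k) = x.
Proof. by apply/rowP => j; rewrite !mxE; case: eqP => // ->. Qed.

Lemma set_coord_eq x k (y : R) : set_coord x k y 0 k = y.
Proof. by rewrite mxE eqxx. Qed.

Lemma set_coord_neq x k j (y : R) : j != k -> set_coord x k y 0 j = x 0 j.
Proof. by rewrite mxE => /negbTE ->. Qed.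

Lemma upd_upd i p (y z : R) : upd i (upd i p y) z = upd i p z.
Proof. by case: i => [k|]//=; rewrite set_coord_set. Qed.

Lemma coord_upd i p (y : R) : Defs.coord i (upd i p y) = y.
Proof. by case: i => [k|]//=; rewrite set_coord_eq. Qed.

Lemma sliceE i (w : 'rV[R]_n * R -> R) p : slice i w p = fun y => w (upd i p y).
Proof. by apply/funext => y; case: i. Qed.

Lemma slice_upd i (w : 'rV[R]_n * R -> R) p (y : R) :
  slice i w (upd i p y) = slice i w p.
Proof. by rewrite !sliceE; apply/funext => z; rewrite upd_upd. Qed.

Lemma Omegabar_set_coord x k (y : R) : Omegabar X x -> seg (X k) y ->
  Omegabar X (set_coord x k y).
Proof. by move=> Ox yX j; rewrite mxE; case: eqP => [->|_]; [exact: yX|exact: Ox]. Qed.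

Lemma upd_QTbar i p (y : R) : QTbar X T p -> seg (len i) y -> QTbar X T (upd i p y).
Proof.
case: i => [k|] [Op tT] yX; split=> //=.
exact: Omegabar_set_coord.
Qed.

Lemma coord_seg i p : QTbar X T p -> seg (len i) (Defs.coord i p).
Proof. by case: i => [k|] [Op tT]//=; exact: Op. Qed.

(** A partial derivative sees only one line in the closed cylinder. So [g], given on the lateral
    surface, may be replaced by [u] in tangential directions. *)
Lemma pd_line i (w1 w2 : 'rV[R]_n * R -> R) p : seg (len i) (Defs.coord i p) ->
  (forall y, seg (len i) y -> w1 (upd i p y) = w2 (upd i p y)) ->
  pd X T i w1 p = pd X T i w2 p.
Proof.
move=> cp e; apply: (@eq_derive_on _ (len i)) => // y yX.
by rewrite !sliceE e.
Qed.

Lemma pd2_line i (w1 w2 : 'rV[R]_n * R -> R) p : seg (len i) (Defs.coord i p) ->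
  (forall y, seg (len i) y -> w1 (upd i p y) = w2 (upd i p y)) ->
  pd2 X T i w1 p = pd2 X T i w2 p.
Proof.
move=> cp e; apply: pd_line => // y yX; apply: pd_line; first by rewrite coord_upd.
by move=> z zX; rewrite !upd_upd e.
Qed.

Lemma ball_row x x' (d : R) : 0 < d -> (forall k, `|x 0 k - x' 0 k| < d) ->
  ball x d x'.
Proof. by move=> d0 H; split=> // i j; rewrite (ord1 i); exact: H. Qed.

(** Contraction towards the midpoint; it takes boundary points inside while moving them little. *)
Definition pull (th L s : R) := s + th * (L / 2 - s).

Lemma pull_in (th L s : R) : 0 < th <= 1 -> 0 < L -> seg L s -> 0 < pull th L s < L.
Proof. by rewrite /seg/pull/= => *; nra. Qed.

Lemma pull_near (th L s : R) : 0 < th -> 0 < L -> seg L s -> `|s - pull th L s| <= th * L.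
Proof. by rewrite /seg/pull/= => *; rewrite ler_norml; nra. Qed.

Lemma pull_small (d L : R) : 0 < d -> 0 < L ->
  exists2 th : R, 0 < th <= 1 & th * L < d.
Proof.
move=> d0 L0; have dL : 0 < d / (d + L) by rewrite divr_gt0// addr_gt0.
exists (d / (d + L)).
  by rewrite dL ler_pdivrMr ?addr_gt0// mul1r lerDl ltW.
by rewrite mulrAC ltr_pdivrMr ?addr_gt0//; nra.
Qed.

Lemma Omega_dense x (d : R) : Omegabar X x -> 0 < d ->
  exists2 x', Omega X x' & ball x d x'.
Proof.
move=> Ox d0; have S0 : 0 < 1 + \sum_k X k.
  by rewrite ltr_pwDl ?sumr_ge0// => k _; rewrite ltW.
have [th th1 thd] := pull_small d0 S0.
have th0 : 0 < th by case/andP: th1.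
exists (\row_k pull th (X k) (x 0 k)).
  by move=> k; rewrite mxE; apply: pull_in => //; exact: Ox.
apply: ball_row => // k; rewrite mxE.
apply: le_lt_trans (pull_near th0 (X_gt0 k) (Ox k)) (le_lt_trans _ thd).
rewrite ler_pM2l// (bigD1 k)//= addrCA lerDl addr_ge0// sumr_ge0// => j _.
exact: ltW.
Qed.

Lemma time_dense (t d : R) : seg T t -> 0 < d -> exists2 t', 0 < t' < T & ball t d t'.
Proof.
move=> tT d0; have [th th1 thd] := pull_small d0 T_gt0.
exists (pull th T t); first exact: pull_in.
by apply: le_lt_trans thd; apply: pull_near => //; case/andP: th1.
Qed.

Lemma QT_dense p (d : R) : QTbar X T p -> 0 < d -> exists2 q, QT X T q & ball p d q.
Proof.
move=> [Op tT] d0; have [x Ox px] := Omega_dense Op d0.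
by have [t tt pt] := time_dense tT d0; exists (x, t).
Qed.

Lemma GammaT_dense p (d : R) : GammaTbar X T p -> 0 < d ->
  exists2 q, GammaT X T q & ball p d q.
Proof.
move=> [Op tT] d0; have [t tt pt] := time_dense tT d0.
by exists (p.1, t) => //; split=> //; exact: ballxx.
Qed.

Lemma GammaTbar_QTbar : GammaTbar X T `<=` QTbar X T.
Proof. by move=> p [[Op _] tT]. Qed.

Lemma QTbar_compact : compact (QTbar X T).
Proof.
rewrite (_ : QTbar X T = [set x : 'rV[R]_n | forall k, [set` `[0, X k]] (x ord0 k)] `*` [set` `[0, T]]).
  apply: compact_setX; last exact: segment_compact.
  by apply: (@rV_compact R n (fun k => [set` `[0, X k]])) => k; exact: segment_compact.
rewrite eqEsubset; split=> -[x t] [/= Ox tT]; split=> //= k;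
  by have := Ox k; rewrite in_itv.
Qed.

Lemma QTbar_bounded (w : 'rV[R]_n * R -> R) : {within QTbar X T, continuous w} ->
  exists2 B : R, 0 <= B & forall p, QTbar X T p -> `|w p| <= B.
Proof.
move=> cw; have /compact_bounded[M [_ HM]] := continuous_compact cw QTbar_compact.
exists (`|M| + 1) => [|p Qp]; first by rewrite addr_ge0.
by apply: (HM (`|M| + 1)); [rewrite (le_lt_trans (ler_norm _))// ltrDl|exists p].
Qed.

(** * Derivatives of [u], and the data expressed through them *)

Section Smooth.
Variables (u : 'rV[R]_n * R -> R).
Hypothesis smooth_u : smooth_upto X T 6 u.
Implicit Types (s : seq (option 'I_n)).

Fact Du_subproof : {D | forall s, D s = foldr (pd X T) u s}.
Proof. by exists (foldr (pd X T) u). Qed.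

(* Opaque, so that different derivatives are told apart without unfolding. *)
Definition Du : seq (option 'I_n) -> 'rV[R]_n * R -> R := sval Du_subproof.

Lemma DuE s : Du s = foldr (pd X T) u s.
Proof. exact: (svalP Du_subproof). Qed.

Lemma Du_nil : Du [::] = u. Proof. exact: DuE. Qed.

Lemma Du_cons i s : Du (i :: s) = pd X T i (Du s).
Proof. by rewrite !DuE. Qed.

Lemma Du_pair i : Du [:: i; i] = pd2 X T i u.
Proof. exact: DuE. Qed.

Lemma Du_continuous s : (size s <= 6)%N -> {within QTbar X T, continuous (Du s)}.
Proof. by move=> s6; rewrite DuE; case: (smooth_u s6). Qed.

(** There are finitely many words of length at most 6, and each derivative is bounded by
    compactness; summing the bounds gives one constant for all. *)
Lemma Du_bounded : exists2 B : R, 0 <= B &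
  forall s p, (size s <= 6)%N -> QTbar X T p -> `|Du s p| <= B.
Proof.
have H j : exists2 B : R, 0 <= B &
    forall s p, size s = j -> (j <= 6)%N -> QTbar X T p -> `|Du s p| <= B.
  have [j6|_] := leqP j 6; last by exists 0.
  have HB (s : j.-tuple (option 'I_n)) : exists B : R, 0 <= B /\
      forall p, QTbar X T p -> `|Du s p| <= B.
    have [|B B0 HB] := QTbar_bounded (Du_continuous (s := s) _).
      by rewrite size_tuple.
    by exists B.
  have [B {}HB] := choice HB.
  exists (\sum_s B s) => [|s p /eqP sj _ Qp]; first by apply: sumr_ge0 => s _; case: (HB s).
  have [_ /(_ p Qp) h] := HB (Tuple sj); apply: le_trans h _.
  by rewrite (bigD1 (Tuple sj))//= lerDl sumr_ge0// => s' _; case: (HB s').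
have /choice[B HB] : forall j : 'I_7, exists B : R, 0 <= B /\
    forall s p, size s = j -> QTbar X T p -> `|Du s p| <= B.
  move=> j; have [B B0 HB] := H j; exists B; split=> // s p sj Qp.
  by apply: HB => //; rewrite -ltnS.
exists (\sum_j B j) => [|s p s6 Qp]; first by apply: sumr_ge0 => j _; case: (HB j).
have [_ /(_ s p erefl Qp) h] := HB (Ordinal (s6 : (size s < 7)%N)).
apply: le_trans h _.
rewrite (bigD1 (Ordinal (s6 : (size s < 7)%N)))//= lerDl sumr_ge0// => j _.
by case: (HB j).
Qed.

Lemma Du_der s i p y : (size s < 6)%N -> QTbar X T p -> seg (len i) y ->
  der (len i) (fun r => Du s (upd i p r)) y (Du (i :: s) (upd i p y)).
Proof.
move=> s6 Qp yX.
have := (smooth_u (ltnW s6)).2 s6 i _ (upd_QTbar Qp yX).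
rewrite -DuE => /(@derivable_onE R (len i)); rewrite coord_upd slice_upd => H.
rewrite [Du (i :: s) _](_ : _ = derive_on (seg (len i)) (slice i (Du s) p) y).
  by rewrite -(sliceE i (Du s)).
by rewrite Du_cons /pd coord_upd slice_upd.
Qed.

Lemma Du_chain K s i p (B : R) : (K + size s <= 6)%N -> QTbar X T p ->
  (forall s p, (size s <= 6)%N -> QTbar X T p -> `|Du s p| <= B) ->
  chain (len i) K (fun j y => Du (nseq j i ++ s) (upd i p y)) B.
Proof.
move=> K6 Qp HB; split=> [j t jK tX|t tX].
  apply: Du_der => //; rewrite size_cat size_nseq.
  by apply: leq_trans K6; rewrite ltn_add2r.
by apply: HB; [rewrite size_cat size_nseq|exact: upd_QTbar].
Qed.

Lemma eq_Du i s s' p : QTbar X T p -> (forall q, QTbar X T q -> Du s q = Du s' q) ->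
  Du (i :: s) p = Du (i :: s') p.
Proof.
move=> Qp e; rewrite !Du_cons; apply: pd_line => [|y yX]; first exact: coord_seg.
by apply: e; exact: upd_QTbar.
Qed.

(** [smooth_upto] gives continuity for every order of differentiation but does not say that the
    orders agree. Both mixed derivatives must be among the continuous ones, hence length at most
    4. *)
Lemma Du_swap k s p : (size s <= 4)%N -> QTbar X T p ->
  Du (None :: Some k :: s) p = Du (Some k :: None :: s) p.
Proof.
move=> s4 Qp; have [Op tT] := Qp; pose pt (y t : R) := (set_coord p.1 k y, t).
have ptp : pt (p.1 0 k) p.2 = p by rewrite /pt set_coord_id; case: (p).
have Qpt y t : seg (X k) y -> seg T t -> QTbar X T (pt y t).
  by move=> yX tT'; split=> //=; exact: Omegabar_set_coord.
have s5 : (size s < 6)%N by exact: leq_trans s4 _.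
have Qp1 t : seg T t -> QTbar X T (p.1, t) by [].
have cont s' : (size s' <= 6)%N -> forall e, 0 < e ->
    exists2 del, 0 < del & forall y t, seg (X k) y -> seg T t ->
    `|y - p.1 0 k| < del -> `|t - p.2| < del -> `|Du s' p - Du s' (pt y t)| < e.
  move=> s'6 e e0; have /within_continuousP/(_ _ _ Qp e0) := Du_continuous s'6.
  move=> [d d0 H]; exists d => // y t yX tT' yd td.
  apply: H; [exact: Qpt|split; last by rewrite distrC in td].
  apply: ball_row => //= j; rewrite mxE; case: eqP => [->|_]; last by rewrite subrr normr0.
  by rewrite distrC.
have := @mixed_derivatives R (X k) T (fun y t => Du s (pt y t))
  (fun y t => Du (Some k :: s) (pt y t)) (fun y t => Du (None :: s) (pt y t))
  (fun y t => Du (Some k :: None :: s) (pt y t))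
  (fun y t => Du (None :: Some k :: s) (pt y t)) (p.1 0 k) p.2.
rewrite ptp => H; apply/esym/H => // {H}; first exact: Op.
- by move=> y t yX tT'; exact: (@Du_der s (Some k) (p.1, t) y s5 (Qp1 t tT') yX).
- by move=> y t yX tT'; exact: (@Du_der s None (pt y t) t s5 (Qpt _ _ yX tT') tT').
- by move=> y t yX tT'; exact: (@Du_der (None :: s) (Some k) (p.1, t) y _ (Qp1 t tT') yX).
- by move=> y t yX tT'; exact: (@Du_der (Some k :: s) None (pt y t) t _ (Qpt _ _ yX tT') tT').
- exact: cont.
- exact: cont.
Qed.

Lemma Du_tkk k p : QTbar X T p ->
  Du [:: None; Some k; Some k] p = Du [:: Some k; Some k; None] p.
Proof.
move=> Qp; apply: (etrans (@Du_swap k [:: Some k] p isT Qp)).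
by apply: eq_Du => // q Qq; exact: (@Du_swap k [::] q isT Qq).
Qed.

Lemma Du_ttkk k p : QTbar X T p ->
  Du [:: None; None; Some k; Some k] p = Du [:: Some k; Some k; None; None] p.
Proof.
move=> Qp; apply: (etrans (@eq_Du None [:: None; Some k; Some k]
  [:: Some k; Some k; None] p Qp (@Du_tkk k))).
apply: (etrans (@Du_swap k [:: Some k; None] p isT Qp)).
by apply: eq_Du => // q Qq; exact: (@Du_swap k [:: None] q isT Qq).
Qed.

Variables (a : 'I_n -> R) (f g : 'rV[R]_n * R -> R) (u0 u1 : 'rV[R]_n -> R).
Hypothesis ibvp_u : ibvp a X T u f g u0 u1.

(** The [j]-th time derivative of [f] in terms of [u]. Differentiability of [f] in time is derived
    from this formula. *)
Definition Df j p : R :=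
  Du (nseq j None ++ [:: None; None]) p -
  \sum_k a k ^+ 2 * Du (nseq j None ++ [:: Some k; Some k]) p.

Lemma f_eq p : QTbar X T p -> f p = Df 0 p.
Proof.
move=> Qp; apply: (@eq_on_closure _ _ (QTbar X T) (QT X T)) => //.
- exact: ibvp_f_cont ibvp_u.
- apply: within_continuousB; first exact: Du_continuous.
  by apply: within_continuous_sum => k; exact: Du_continuous.
- move=> q [Oq /andP[t0 tT]]; split=> [k|/=]; last by rewrite !ltW.
  by have /andP[x0 xX] := Oq k; rewrite !ltW.
- move=> q Qq; rewrite -(ibvp_eq ibvp_u Qq) /Df Du_pair; congr (_ - _).
  by apply: eq_bigr => k _; rewrite Du_pair.
- by move=> d; exact: QT_dense.
Qed.

Lemma g_eq p : GammaTbar X T p -> u p = g p.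
Proof.
move=> Gp; apply: (@eq_on_closure _ _ (GammaTbar X T) (GammaT X T)) => //.
- by apply: (continuous_subspaceW GammaTbar_QTbar); rewrite -Du_nil; exact: Du_continuous.
- exact: ibvp_g_cont ibvp_u.
- by move=> q [Oq /andP[t0 tT]]; split=> //=; rewrite !ltW.
- exact: ibvp_bd ibvp_u.
- by move=> d; exact: GammaT_dense.
Qed.

Lemma initial_continuous (w : 'rV[R]_n * R -> R) : {within QTbar X T, continuous w} ->
  {within Omegabar X, continuous (fun x => w (x, 0))}.
Proof.
move=> /within_continuousP cw; apply/within_continuousP => x e Ox e0.
have Q0 y : Omegabar X y -> QTbar X T (y, 0) by move=> Oy; split=> //=; rewrite lexx ltW.
have [d d0 H] := cw (x, 0) e (Q0 x Ox) e0; exists d => // y Oy xy.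
by apply: H; [exact: Q0|split=> //; exact: ballxx].
Qed.

Lemma u0_eq x : Omegabar X x -> u (x, 0) = u0 x.
Proof.
move=> Ox; apply: (@eq_on_closure _ _ (Omegabar X) (Omega X) (fun x => u (x, 0))) => //.
- by apply: initial_continuous; rewrite -Du_nil; exact: Du_continuous.
- exact: ibvp_u0_cont ibvp_u.
- by move=> y Oy k; have /andP[x0 xX] := Oy k; rewrite !ltW.
- exact: ibvp_init0 ibvp_u.
- by move=> d; exact: Omega_dense.
Qed.

Lemma u1_eq x : Omegabar X x -> Du [:: None] (x, 0) = u1 x.
Proof.
move=> Ox; apply: (@eq_on_closure _ _ (Omegabar X) (Omega X)
  (fun x => Du [:: None] (x, 0))) => //.
- by apply: initial_continuous; exact: (@Du_continuous [:: None]).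
- exact: ibvp_u1_cont ibvp_u.
- by move=> y Oy k; have /andP[x0 xX] := Oy k; rewrite !ltW.
- by move=> y Oy; rewrite Du_cons Du_nil (ibvp_init1 ibvp_u).
- by move=> d; exact: Omega_dense.
Qed.

(** On a face normal to [x_k] every derivative of [g] used is tangential, and the equation is solved
    for [a_k^2 d_k^2 u]; elsewhere on the boundary [x_k] itself is tangential. *)
Lemma bdata_eq k p : GammaTbar X T p ->
  bdata a X T f g k p = a k ^+ 2 * Du [:: Some k; Some k] p.
Proof.
move=> Gp; have Qp := GammaTbar_QTbar Gp.
have [[Op NOp] tT] := Gp.
have pd2g i : (forall y, seg (len i) y -> GammaTbar X T (upd i p y)) ->
    pd2 X T i g p = Du [:: i; i] p.
  move=> H; rewrite Du_pair; apply/esym/pd2_line => [|y yX]; first exact: coord_seg.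
  by apply: g_eq; exact: H.
rewrite /bdata; case: ifPn => [pk|].
  rewrite pd2g => [|y yT]; last by split.
  rewrite (eq_bigr (fun l => a l ^+ 2 * Du [:: Some l; Some l] p)) => [|l lk]; last first.
    rewrite pd2g// => y yX; split=> //=; split; first exact: Omegabar_set_coord.
    move=> /(_ k); rewrite set_coord_neq 1?eq_sym//.
    by case/orP: pk => /eqP ->; rewrite ltxx ?andbF.
  have -> : f p = Du [:: None; None] p - \sum_l a l ^+ 2 * Du [:: Some l; Some l] p.
    exact: f_eq.
  pose F l := a l ^+ 2 * Du [:: Some l; Some l] p.
  have e : \sum_l F l = F k + \sum_(l | l != k) F l by rewrite (bigD1 k).
  rewrite e -/(F k); ring.
rewrite negb_or => /andP[p0 pX]; rewrite pd2g// => y yX; split=> //=.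
split; first exact: Omegabar_set_coord.
(* Were the moved point interior, [p] would be so too, as its own [k]-th coordinate is off both
   ends. *)
move=> H; apply: NOp => j; have [->|jk] := eqVneq j k.
  by have /andP[h0 hX] := Op k; rewrite !lt_def p0 h0 hX eq_sym pX.
by have := H j; rewrite set_coord_neq.
Qed.

Lemma Df_chain x (B : R) : Omegabar X x ->
  (forall s p, (size s <= 6)%N -> QTbar X T p -> `|Du s p| <= B) ->
  chain T 4 (fun j t => Df j (x, t)) ((1 + \sum_k a k ^+ 2) * B).
Proof.
move=> Ox HB; have Q0 t : seg T t -> QTbar X T (x, t) by [].
split=> [j t j4 tT|t tT].
  apply: derB.
    apply: (@Du_der (nseq j None ++ _) None (x, t) t _ (Q0 t tT) tT).
    by rewrite size_cat size_nseq addn2 !ltnS.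
  apply: der_sum => k _; apply: derZ.
  apply: (@Du_der (nseq j None ++ _) None (x, t) t _ (Q0 t tT) tT).
  by rewrite size_cat size_nseq addn2 !ltnS.
rewrite mulrDl mul1r; apply: ler_normD_eq; [by []|by apply: HB => //; exact: Q0|].
rewrite normrN mulr_suml; apply: le_trans (ler_norm_sum _ _ _) _.
apply: ler_sum => k _; rewrite normrM ger0_norm ?sqr_ge0// ler_wpM2l ?sqr_ge0//.
by apply: HB => //; exact: Q0.
Qed.

Lemma pd_f x t : Omegabar X x -> seg T t -> pd X T None f (x, t) = Df 1 (x, t).
Proof.
move=> Ox tT; have [B _ HB] := Du_bounded; have [C _] := Df_chain Ox HB.
rewrite (@pd_line None f (Df 0) (x, t)) => [|//|y yT]; last exact: f_eq.
by apply: (derive_onE T_gt0 tT); exact: (C 0%N).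
Qed.

Lemma pd2_f x t : Omegabar X x -> seg T t -> pd2 X T None f (x, t) = Df 2 (x, t).
Proof.
move=> Ox tT; have [B _ HB] := Du_bounded; have [C _] := Df_chain Ox HB.
rewrite /pd2 (@pd_line None _ (Df 1) (x, t)) => [|//|y yT]; last exact: pd_f.
by apply: (derive_onE T_gt0 tT); exact: (C 1%N).
Qed.

End Smooth.
End Cylinder.

(** * Absorbing powers of the time step into powers of the space steps *)

Section TruncationArithmetic.
Variable R : realType.
Implicit Types B S C q T t x y : R.

(** To be read with [x = h_t^2], [y = |h|^2] and [S = \sum_k a_k^2]; the left side is the bound of
    [psi_bound]. *)
Lemma interior_arith B S q x y : 0 <= B -> 0 <= S -> 0 <= x -> 0 <= y ->
  0 <= q -> x <= q * y ->
  2 * B * x ^+ 2 + x / 12 * (2 * B * S * y + 2 * ((1 + S) * B) * x) <=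
  (2 * B * q ^+ 2 + q * (2 * B * S + 2 * ((1 + S) * B) * q)) * y ^+ 2.
Proof.
move=> B0 S0 x0 y0 q0 xqy.
have xx : x ^+ 2 <= q ^+ 2 * y ^+ 2 by rewrite -exprMn ler_sqr ?nnegrE// mulr_ge0.
have xy : x * y <= q * y ^+ 2 by rewrite expr2 mulrA ler_wpM2r.
have BS0 := mulr_ge0 B0 S0.
have b1 := ler_wpM2l B0 xx; have b2 := ler_wpM2l BS0 xy; have b3 := ler_wpM2l BS0 xx.
have c1 := mulr_ge0 B0 (sqr_ge0 x); have c2 := mulr_ge0 BS0 (mulr_ge0 x0 y0).
have c3 := mulr_ge0 BS0 (sqr_ge0 x).
by lra.
Qed.

(** Here [t = h_t], unsquared because odd powers occur; the spare factor in [t^3 y] is bounded by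
    [T]. *)
Lemma first_arith B S C q T t y : 0 <= B -> 0 <= S -> 0 <= C -> 0 <= y -> 0 <= q ->
  0 <= t <= T -> t ^+ 2 <= q * y ->
  B * t ^+ 4 + (t ^+ 2 / 6 * (2 * B * S * y) + t ^+ 3 / 24 * (2 * B * S * y) +
    t / 2 * (C * t ^+ 3)) <=
  (B * q ^+ 2 + (q * (2 * B * S) + T * q * (2 * B * S) + C * q ^+ 2)) * y ^+ 2.
Proof.
move=> B0 S0 C0 y0 q0 /andP[t0 tT] xqy.
have T0 := le_trans t0 tT.
have xx : t ^+ 4 <= q ^+ 2 * y ^+ 2.
  by rewrite (exprM _ 2 2) -exprMn ler_sqr ?nnegrE ?sqr_ge0// mulr_ge0.
have xy : t ^+ 2 * y <= q * y ^+ 2 by rewrite [y ^+ 2]expr2 mulrA ler_wpM2r.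
have BS0 := mulr_ge0 B0 S0.
have b1 := ler_wpM2l B0 xx; have b2 := ler_wpM2l BS0 xy; have b3 := ler_wpM2l C0 xx.
have xy0 : 0 <= B * S * (t ^+ 2 * y) by rewrite !mulr_ge0 ?sqr_ge0.
have qy0 : 0 <= B * S * (q * y ^+ 2) by rewrite !mulr_ge0 ?sqr_ge0.
have b4 : t * (B * S * (t ^+ 2 * y)) <= T * (B * S * (q * y ^+ 2)) by exact: ler_pM.
have c1 := mulr_ge0 t0 xy0; have c2 : 0 <= C * t ^+ 4 by rewrite mulr_ge0// exprn_ge0.
by lra.
Qed.

Lemma le_of_sqr x y : 0 <= y -> x ^+ 2 <= y ^+ 2 -> x <= y.
Proof. by move=> y0; rewrite leNgt => xy; rewrite leNgt; apply: contraNN xy => yx; nra. Qed.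

End TruncationArithmetic.

(** * Truncation errors at the mesh nodes *)

Section MeshConsistency.
Variables (R : realType) (n : nat) (a X : 'I_n -> R) (T : R).
Variables (N : 'I_n -> nat) (M : nat) (h : 'I_n -> R) (ht : R).
Hypotheses (X_gt0 : forall k, 0 < X k) (T_gt0 : 0 < T).
Hypotheses (h_gt0 : forall k, 0 < h k) (ht_gt0 : 0 < ht).
Hypotheses (hN : forall k, (N k)%:R * h k = X k) (htM : M%:R * ht = T).
Implicit Types (l : grid N) (k : 'I_n) (m : nat).

Lemma nodeE l k : node h l 0 k = (l k)%:R * h k.
Proof. by rewrite mxE. Qed.

Lemma node_Omegabar l : Omegabar X (node h l).
Proof.
move=> k; rewrite nodeE mulr_ge0 ?(ltW (h_gt0 k))//= -hN ler_pM2r// ler_nat.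
by rewrite -ltnS.
Qed.

Lemma time_seg m : (m <= M)%N -> seg T (m%:R * ht).
Proof. by move=> mM; rewrite /seg/= mulr_ge0 ?(ltW ht_gt0)//= -htM ler_pM2r// ler_nat. Qed.

Lemma node_next k l : (l k < N k)%N ->
  node h (next_node k l) = set_coord (node h l) k (node h l 0 k + h k).
Proof.
move=> lN; apply/rowP => j; rewrite [RHS]mxE nodeE; case: eqVneq => [->|jk].
  by rewrite next_nodeE// nodeE -natr1 mulrDl mul1r.
by rewrite next_node_neq// nodeE.
Qed.

Lemma node_prev k l : (0 < l k)%N ->
  node h (prev_node k l) = set_coord (node h l) k (node h l 0 k - h k).
Proof.
move=> lN; apply/rowP => j; rewrite [RHS]mxE nodeE; case: eqVneq => [->|jk].
  by rewrite prev_nodeE nodeE -{2}(prednK lN) -natr1 mulrDl mul1r addrK.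
by rewrite prev_node_neq// nodeE.
Qed.

Lemma node_bdOmega l : l \in bd_omega_h N -> bdOmega X (node h l).
Proof.
rewrite finset.in_setC => lN; split; first exact: node_Omegabar.
move=> H; move/negP: lN; apply; apply/omegaP => k.
have := H k; rewrite nodeE pmulr_lgt0// ltr0n => /andP[-> /=].
by rewrite -hN ltr_pM2r// ltr_nat.
Qed.

Lemma node_GammaTbar l m : l \in bd_omega_h N -> (m <= M)%N ->
  GammaTbar X T (node h l, m%:R * ht).
Proof. by move=> lb mM; split; [exact: node_bdOmega|exact: time_seg]. Qed.

Lemma node_QTbar l m : (m <= M)%N -> QTbar X T (node h l, m%:R * ht).
Proof. by move=> mM; split; [exact: node_Omegabar|exact: time_seg]. Qed.

Lemma node_seg k l : l \in omega_h N ->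
  [/\ seg (X k) (node h l 0 k), seg (X k) (node h l 0 k - h k) &
      seg (X k) (node h l 0 k + h k)].
Proof.
move=> /omegaP lN; have /andP[l0 lk] := lN k; rewrite /seg/=.
have hk := h_gt0 k; have := node_Omegabar (prev_node k l) k.
have := node_Omegabar (next_node k l) k.
rewrite node_next// node_prev// !set_coord_eq; have := node_Omegabar l k.
by split; lra.
Qed.

Variables (u f g : 'rV[R]_n * R -> R) (u0 u1 : 'rV[R]_n -> R) (B : R).
Hypothesis smooth_u : smooth_upto X T 6 u.
Hypothesis ibvp_u : ibvp a X T u f g u0 u1.
Hypothesis HB : forall s p, (size s <= 6)%N -> QTbar X T p -> `|Du X T u s p| <= B.

Lemma restr_tE (w : 'rV[R]_n * R -> R) m l :
  restr_t N h ht w m l = w (node h l, m%:R * ht).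
Proof. by rewrite ffunE. Qed.

Local Notation U s := (restr_t N h ht (Du X T u s)).
Local Notation F j := (restr_t N h ht (Df X T u a j)).

Lemma trunc_Lam k s m l : (size s <= 2)%N -> (m <= M)%N -> l \in omega_h N ->
  `|Lam h k (U s m) l - U (Some k :: Some k :: s) m l| <= 2 * B * h k ^+ 2.
Proof.
move=> s2 mM lN; have /omegaP/(_ k)/andP[l0 lk] := lN.
have Q := node_QTbar l mM; have [sX smX spX] := node_seg k lN.
have K6 : (4 + size s <= 6)%N by exact: (leq_add (leqnn 4) s2).
have := second_difference4 (Du_chain smooth_u (Some k) K6 Q HB) (h_gt0 k) smX spX.
by rewrite /= set_coord_id -node_next// -node_prev// [Lam _ _ _ _]ffunE lN !restr_tE.
Qed.

Lemma trunc_Lh s m l : (size s <= 2)%N -> (m <= M)%N -> l \in omega_h N ->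
  `|Lh a h (U s m) l - \sum_k a k ^+ 2 * U (Some k :: Some k :: s) m l| <=
  2 * B * (\sum_k a k ^+ 2) * (\sum_k h k ^+ 2).
Proof.
move=> s2 mM lN; rewrite ffunE -sumrB mulrAC mulr_sumr.
apply: le_trans (ler_norm_sum _ _ _) _; apply: ler_sum => k _.
rewrite -mulrBr normrM ger0_norm ?sqr_ge0// mulrC ler_wpM2r ?sqr_ge0//.
apply: le_trans (trunc_Lam k s2 mM lN) _.
have B0 : 0 <= B by apply: le_trans (HB (s := [::]) isT (node_QTbar l mM)).
rewrite ler_wpM2l ?mulr_ge0// (bigD1 k)//= lerDl sumr_ge0// => j _.
exact: sqr_ge0.
Qed.

Lemma trunc_sN k m l : (m <= M)%N -> l \in omega_h N ->
  `|sN k (U [:: Some k; Some k] m) l - Lam h k (U [::] m) l| <= 3 * B * h k ^+ 4.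
Proof.
move=> mM lN; have /omegaP/(_ k)/andP[l0 lk] := lN.
have Q := node_QTbar l mM; have [sX smX spX] := node_seg k lN.
have := numerov (Du_chain smooth_u (K := 6) (s := [::]) (Some k) isT Q HB)
  (h_gt0 k) smX spX.
rewrite /= set_coord_id -node_next// -node_prev// [Lam _ _ _ _]ffunE lN.
by rewrite [sN _ _ _]ffunE lN !restr_tE.
Qed.

Lemma time_shift m : (0 < m < M)%N ->
  [/\ m.-1%:R * ht = m%:R * ht - ht, m.+1%:R * ht = m%:R * ht + ht,
      seg T (m%:R * ht - ht) & seg T (m%:R * ht + ht)].
Proof.
move=> /andP[m0 mM].
have e1 : m.-1%:R * ht = m%:R * ht - ht.
  by rewrite -[in RHS](prednK m0) -natr1 mulrDl mul1r addrK.
have e2 : m.+1%:R * ht = m%:R * ht + ht by rewrite -natr1 mulrDl mul1r.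
split; [exact: e1|exact: e2|rewrite -e1|rewrite -e2]; apply: time_seg => //.
exact: leq_trans (leq_pred m) (ltnW mM).
Qed.

Lemma trunc_Lam_t m l : (0 < m < M)%N ->
  `|Lam_t ht (U [::]) m l - (U [:: None; None] m l +
     ht ^+ 2 / 12 * U [:: None; None; None; None] m l)| <= 2 * B * ht ^+ 4.
Proof.
move=> mM; have [em ep sm sp] := time_shift mM.
have mM' : (m <= M)%N by case/andP: mM => _ /ltnW.
have Q := node_QTbar l mM'.
have := second_difference6 (Du_chain smooth_u (K := 6) (s := [::]) None isT Q HB)
  ht_gt0 sm sp.
by rewrite /= -em -ep [Lam_t _ _ _ _]ffunE !restr_tE.
Qed.

Lemma trunc_f m l : (0 < m < M)%N ->
  `|Lam_t ht (restr_t N h ht f) m l - F 2 m l| <=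
    2 * ((1 + \sum_k a k ^+ 2) * B) * ht ^+ 2.
Proof.
move=> mM; have [em ep sm sp] := time_shift mM.
have [m0 mM'] := andP mM; have feq m' : (m' <= M)%N ->
    f (node h l, m'%:R * ht) = Df X T u a 0 (node h l, m'%:R * ht).
  by move=> m'M; apply: (f_eq X_gt0 T_gt0 smooth_u ibvp_u); exact: node_QTbar.
have := second_difference4 (Df_chain smooth_u a (node_Omegabar l) HB)
  ht_gt0 sm sp.
rewrite -em -ep [Lam_t _ _ _ _]ffunE !restr_tE !feq ?(ltnW mM')//.
exact: leq_trans (leq_pred m) (ltnW mM').
Qed.

Lemma trunc_first l : (0 < M)%N ->
  `|delta_t ht (U [::]) 0 l - (U [:: None] 0 l + ht / 2 * U [:: None; None] 0 l +
    ht ^+ 2 / 6 * U [:: None; None; None] 0 l +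
    ht ^+ 3 / 24 * U [:: None; None; None; None] 0 l)| <= B * ht ^+ 4.
Proof.
move=> M0; have Q := node_QTbar l (leq0n M).
have sp : seg T ht by have := @time_seg 1 M0; rewrite mul1r.
have := first_difference (Du_chain smooth_u (K := 5) (s := [::]) None isT Q HB)
  ht_gt0 sp.
by rewrite /= [delta_t _ _ _ _]ffunE !restr_tE mul0r mul1r.
Qed.

Let S := \sum_k a k ^+ 2.
Let H2 := \sum_k h k ^+ 2.
Let c := ht ^+ 2 / 12.

Lemma f_node l m : (m <= M)%N ->
  restr_t N h ht f m l = U [:: None; None] m l -
    \sum_k a k ^+ 2 * U [:: Some k; Some k] m l.
Proof.
move=> mM; rewrite !restr_tE (f_eq X_gt0 T_gt0 smooth_u ibvp_u (node_QTbar l mM)).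
by congr (_ - _); apply: eq_bigr => k _; rewrite restr_tE.
Qed.

Lemma wsum_node m : (m <= M)%N ->
  wsum a (fun k => U [:: Some k; Some k] m) = U [:: None; None] m - restr_t N h ht f m.
Proof.
move=> mM; apply/ffunP => l.
by rewrite [LHS]ffunE [RHS]ffunE [X in _ + X]ffunE f_node// opprB addrC subrK.
Qed.

Lemma Lam_linB k (v w : meshfun R N) l : Lam h k (v - w) l = Lam h k v l - Lam h k w l.
Proof. by rewrite !ffunE; case: (l \in omega_h N); ring. Qed.

Lemma Lh_linB (v w : meshfun R N) l : Lh a h (v - w) l = Lh a h v l - Lh a h w l.
Proof.
rewrite ffunE [X in _ = X - _]ffunE [X in _ = _ - X]ffunE -sumrB.
by apply: eq_bigr => k _; rewrite Lam_linB mulrBr.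
Qed.

Lemma I_plus_Lh_subE d (v w : meshfun R N) l : I_plus_Lh a h d (v - w) l =
  (v l - w l) + d * (Lh a h v l - Lh a h w l).
Proof.
rewrite ffunE Lh_linB; congr (_ + _).
by rewrite !ffunE.
Qed.

Definition psi m : {ffun grid N -> R} := [ffun l => if l \in omega_h N then
  Lam_t ht (U [::]) m l -
  I_plus_Lh a h c (wsum a (fun k => U [:: Some k; Some k] m)) l -
  fh N a h ht f m l else 0].

(** By the equation the weighted sum of second derivatives is [u_tt - f], so the terms with [L_h f]
    cancel and [psi] is [Lambda_t u - u_tt - c (L_h u_tt + Lambda_t f)]. It is small because
    [u_tttt = f_tt + \sum_k a_k^2 d_k^2 u_tt]. *)
Lemma psi_bound m l : (0 < m < M)%N -> `|psi m l| <=
  2 * B * ht ^+ 4 + c * (2 * B * S * H2 + 2 * ((1 + S) * B) * ht ^+ 2).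
Proof.
move=> mM; have mM' : (m <= M)%N by case/andP: mM => _ /ltnW.
have B0 : 0 <= B by apply: le_trans (HB (s := [::]) isT (node_QTbar l mM')).
have S0 : 0 <= S by apply: sumr_ge0 => k _; exact: sqr_ge0.
have H20 : 0 <= H2 by apply: sumr_ge0 => k _; exact: sqr_ge0.
have c0 : 0 <= c by rewrite divr_ge0 ?sqr_ge0.
rewrite [psi m l]ffunE; case: ifPn => [lN|_]; last first.
  by rewrite normr0 !(addr_ge0, mulr_ge0)// ?exprn_ge0// ltW.
have t1 := trunc_Lam_t l mM; have t2 := trunc_f l mM.
have t3 := @trunc_Lh [:: None; None] m l isT mM' lN.
rewrite wsum_node// I_plus_Lh_subE.
rewrite [fh _ _ _ _ _ _ _]ffunE.
have e : U [:: None; None; None; None] m l = F 2 m l +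
    \sum_k a k ^+ 2 * U [:: Some k; Some k; None; None] m l.
  rewrite !restr_tE /Df /= -[LHS](subrK (\sum_k a k ^+ 2 *
    Du X T u [:: None; None; Some k; Some k] (node h l, m%:R * ht))); congr (_ + _).
  apply: eq_bigr => k _; rewrite restr_tE; congr (_ * _).
  exact: (Du_ttkk X_gt0 T_gt0 smooth_u k (node_QTbar l mM')).
rewrite {}e in t1; rewrite -/c in t1 *.
have t23 : `|c * (Lh a h (U [:: None; None] m) l -
     \sum_k a k ^+ 2 * U [:: Some k; Some k; None; None] m l +
     (Lam_t ht (restr_t N h ht f) m l - F 2 m l))| <=
     c * (2 * B * S * H2 + 2 * ((1 + S) * B) * ht ^+ 2).
  rewrite normrM (ger0_norm c0) ler_wpM2l//.
  exact: ler_normD_eq t3 t2.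
rewrite -normrN in t23; apply: ler_normD_eq t1 t23; ring.
Qed.

Variables (fd : meshfun R N) (Cd : R).

Definition psi0 : {ffun grid N -> R} := [ffun l => if l \in omega_h N then
  delta_t ht (U [::]) 0 l -
  (ht / 2 * I_plus_Lh a h c (wsum a (fun k => U [:: Some k; Some k] 0%N)) l
      + I_plus_Lh a h (ht ^+ 2 / 6) (restr N h u1) l
      + ht / 2 * (fd l + ht ^+ 2 / 12 * Lh a h (restr_t N h ht f 0) l)) else 0].

Hypothesis M_gt0 : (0 < M)%N.
Hypothesis fd_approx : forall l, l \in omega_h N ->
  `|fd l - (f (node h l, 0) + ht / 3 * pd X T None f (node h l, 0)
     + ht ^+ 2 / 12 * pd2 X T None f (node h l, 0))| <= Cd * ht ^+ 3.

(** The equation differentiated in [t] once and twice eliminates [u_ttt] and [u_tttt] from the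
    Taylor expansion. This leaves [h_t^2/6 f_t + h_t^3/24 f_tt], which is [h_t/2] times the
    corrections [h_t/3 f_t + h_t^2/12 f_tt] contained in [fd]. *)
Lemma psi0_bound l : `|psi0 l| <= B * ht ^+ 4 +
  (ht ^+ 2 / 6 * (2 * B * S * H2) + ht ^+ 3 / 24 * (2 * B * S * H2) +
   ht / 2 * (`|Cd| * ht ^+ 3)).
Proof.
have B0 : 0 <= B by apply: le_trans (HB (s := [::]) isT (node_QTbar l (leq0n M))).
have S0 : 0 <= S by apply: sumr_ge0 => k _; exact: sqr_ge0.
have H20 : 0 <= H2 by apply: sumr_ge0 => k _; exact: sqr_ge0.
have htn j : 0 <= ht ^+ j by rewrite exprn_ge0// ltW.
have ht2 : 0 <= ht / 2 by rewrite divr_ge0// ltW.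
have c6 : 0 <= ht ^+ 2 / 6 by rewrite divr_ge0.
have c24 : 0 <= ht ^+ 3 / 24 by rewrite divr_ge0.
rewrite [psi0 l]ffunE; case: ifPn => [lN|_]; last first.
  by rewrite normr0 !(addr_ge0, mulr_ge0)// ?invr_ge0 ?exprn_ge0 ?(ltW ht_gt0).
have Q := node_QTbar l (leq0n M); have Ox := node_Omegabar l.
have s0 : seg T 0 by rewrite /seg/= lexx ltW.
have t1 := trunc_first l M_gt0.
have t2 := @trunc_Lh [:: None; None] 0 l isT (leq0n M) lN.
have t3 := @trunc_Lh [:: None] 0 l isT (leq0n M) lN.
have t4 : `|fd l - (restr_t N h ht f 0 l + ht / 3 * F 1 0 l + ht ^+ 2 / 12 * F 2 0 l)|
    <= `|Cd| * ht ^+ 3.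
  rewrite !restr_tE mul0r -(pd_f X_gt0 T_gt0 smooth_u ibvp_u Ox s0).
  rewrite -(pd2_f X_gt0 T_gt0 smooth_u ibvp_u Ox s0).
  by apply: le_trans (fd_approx lN) _; rewrite ler_wpM2r// ler_norm.
have -> : restr N h u1 = U [:: None] 0%N.
  apply/ffunP => l'; rewrite ffunE restr_tE mul0r.
  by rewrite (u1_eq X_gt0 T_gt0 smooth_u ibvp_u (node_Omegabar l')).
rewrite wsum_node// I_plus_Lh_subE.
have e4 : U [:: None; None; None; None] 0%N l = F 2 0%N l +
    \sum_k a k ^+ 2 * U [:: Some k; Some k; None; None] 0%N l.
  rewrite !restr_tE /Df /= -[LHS](subrK (\sum_k a k ^+ 2 *
    Du X T u [:: None; None; Some k; Some k] (node h l, 0%:R * ht))); congr (_ + _).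
  apply: eq_bigr => k _; rewrite restr_tE; congr (_ * _).
  exact: (Du_ttkk X_gt0 T_gt0 smooth_u k Q).
have e3 : U [:: None; None; None] 0%N l = F 1 0%N l +
    \sum_k a k ^+ 2 * U [:: Some k; Some k; None] 0%N l.
  rewrite !restr_tE /Df /= -[LHS](subrK (\sum_k a k ^+ 2 *
    Du X T u [:: None; Some k; Some k] (node h l, 0%:R * ht))); congr (_ + _).
  apply: eq_bigr => k _; rewrite restr_tE; congr (_ * _).
  exact: (Du_tkk X_gt0 T_gt0 smooth_u k Q).
rewrite {}e4 {}e3 in t1.
have t3' : `|- (ht ^+ 2 / 6 * (Lh a h (U [:: None] 0%N) l -
    \sum_k a k ^+ 2 * U [:: Some k; Some k; None] 0%N l))| <=
    ht ^+ 2 / 6 * (2 * B * S * H2).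
  by rewrite normrN normrM (ger0_norm c6) ler_wpM2l.
have t2' : `|- (ht ^+ 3 / 24 * (Lh a h (U [:: None; None] 0%N) l -
    \sum_k a k ^+ 2 * U [:: Some k; Some k; None; None] 0%N l))| <=
    ht ^+ 3 / 24 * (2 * B * S * H2).
  by rewrite normrN normrM (ger0_norm c24) ler_wpM2l.
have t4' : `|- (ht / 2 * (fd l - (restr_t N h ht f 0 l + ht / 3 * F 1 0 l +
    ht ^+ 2 / 12 * F 2 0 l)))| <= ht / 2 * (`|Cd| * ht ^+ 3).
  by rewrite normrN normrM (ger0_norm ht2) ler_wpM2l.
have t := ler_normD_eq erefl (ler_normD_eq erefl t3' t2') t4'.
by apply: ler_normD_eq t1 t; rewrite /c [I_plus_Lh _ _ _ _ _]ffunE; field.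
Qed.

(** * The error equations *)

Hypothesis a_gt0 : forall k, 0 < a k.
Variables (v : nat -> meshfun R N) (vv : 'I_n -> nat -> meshfun R N).
Hypothesis sch : scheme M a X T h ht f g u0 u1 fd v vv.
Local Notation V := {ffun grid N -> R}.
Implicit Types (w z : V).

Lemma add_apply w z l : (w + z) l = w l + z l. Proof. by rewrite ffunE. Qed.

Lemma sub_apply w z l : (w - z) l = w l - z l. Proof. by rewrite !ffunE. Qed.

Lemma scale_apply d w l : (d *: w) l = d * w l. Proof. by rewrite ffunE. Qed.

Lemma Hh_eq w z : Hh w -> Hh z -> (forall l, l \in omega_h N -> w l = z l) -> w = z.
Proof.
move=> Hw Hz e; apply/ffunP => l; have [/e//|lN] := boolP (l \in omega_h N).
by rewrite Hw ?Hz// finset.in_setC.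
Qed.

Lemma HhD w z : Hh w -> Hh z -> Hh (w + z).
Proof. by move=> Hw Hz l lb; rewrite ffunE Hw// Hz// addr0. Qed.

Lemma HhZ d w : Hh w -> Hh (d *: w).
Proof. by move=> Hw l lb; rewrite ffunE Hw// scaler0. Qed.

Lemma HhB w z : Hh w -> Hh z -> Hh (w - z).
Proof. by move=> Hw Hz; rewrite -scaleN1r; apply/HhD/HhZ. Qed.

Lemma Hh_sum (I : Type) (s : seq I) (w : I -> V) :
  (forall i, Hh (w i)) -> Hh (\sum_(i <- s) w i).
Proof.
move=> H; elim/big_ind: _ => [l lb||i _]; [by rewrite ffunE| |exact: H].
by move=> x y; exact: HhD.
Qed.

Lemma G0_Hh w : Hh w -> Hh (G0 h a ht w).
Proof. by move=> Hw; apply/HhD/HhZ => //; apply: Hh_sum => k; apply/HhZ/Lam_Hh. Qed.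

Definition err m : V := restr_t N h ht u m - v m.
Definition aux_err k m : V := U [:: Some k; Some k] m - vv k m.
Definition psik k m : V := sN k (U [:: Some k; Some k] m) - Lam h k (U [::] m).
Definition aux_psi m : V := \sum_k a k ^+ 2 *: tN k (psik k m).

Lemma err0 : err 0 = 0.
Proof.
apply/ffunP => l; rewrite sub_apply restr_tE mul0r ffunE.
rewrite (scheme_init sch) (u0_eq X_gt0 T_gt0 smooth_u ibvp_u (node_Omegabar l)).
exact: subrr.
Qed.

Lemma err_Hh m : (m <= M)%N -> Hh (err m).
Proof.
case: m => [_ l lb|m mM l lb]; first by rewrite err0 ffunE.
rewrite /err ?/aux_err sub_apply restr_tE (scheme_bd sch) ?ltnS// -?ltnS//.
rewrite (g_eq T_gt0 smooth_u ibvp_u (node_GammaTbar lb mM)).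
exact: subrr.
Qed.

Lemma aux_err_Hh k m : (m < M)%N -> Hh (aux_err k m).
Proof.
move=> mM l lb; rewrite /err ?/aux_err sub_apply restr_tE.
have mM' : (m <= M.-1)%N by rewrite -ltnS (prednK M_gt0).
apply: (@mulfI _ (a k ^+ 2)); first by rewrite expf_neq0// gt_eqF.
rewrite mulrBr (scheme_bd_aux sch)// mulr0.
rewrite (bdata_eq X_gt0 T_gt0 smooth_u ibvp_u k (node_GammaTbar lb (ltnW mM))).
exact: subrr.
Qed.

Lemma sN_linB k (w z : meshfun R N) l : sN k (w - z) l = sN k w l - sN k z l.
Proof. by rewrite !ffunE; case: (l \in omega_h N); ring. Qed.

Lemma psik_Hh k m : Hh (psik k m).
Proof.
move=> l lb; rewrite /psik sub_apply (Lam_Hh h k _ lb) subr0.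
by rewrite ffunE; move: lb; rewrite finset.in_setC => /negbTE ->.
Qed.

Lemma aux_errE k m : (m < M)%N ->
  aux_err k m = tN k (Lam0 h k (err m)) + tN k (psik k m).
Proof.
move=> mM; have mM' : (m <= M.-1)%N by rewrite -ltnS (prednK M_gt0).
rewrite -(symD (sym_tN h_gt0 k)); apply/esym/(tN_uniq h_gt0).
rewrite -sN0E//; last exact: aux_err_Hh.
rewrite inner_part_id; last by apply: HhD; [exact: Lam_Hh|exact: psik_Hh].
apply: Hh_eq => [l lb||l lN].
- by rewrite ffunE; move: lb; rewrite finset.in_setC => /negbTE ->.
- by apply: HhD; [exact: Lam_Hh|exact: psik_Hh].
rewrite /aux_err sN_linB (scheme_aux sch)//.
rewrite add_apply /psik sub_apply /Lam0 inner_part_id; last first.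
  exact/err_Hh/ltnW.
rewrite /err Lam_linB Du_nil; ring.
Qed.

Lemma wsum_aux m : (m < M)%N ->
  wsum a (aux_err ^~ m) = aux_psi m - B0 h a (err m).
Proof.
move=> mM; rewrite /aux_psi /B0 opprK -big_split /=; apply/ffunP => l.
rewrite ffunE sum_ffunE; apply: eq_bigr => k _.
by rewrite aux_errE// -scalerDr [RHS]ffunE addrC.
Qed.

Lemma aux_psi_Hh m : Hh (aux_psi m).
Proof. by apply: Hh_sum => k; apply/HhZ/(tN_Hh h_gt0). Qed.

Lemma wsum_vv m : wsum a (vv ^~ m) =
  wsum a (fun k => U [:: Some k; Some k] m) - wsum a (aux_err ^~ m).
Proof.
apply/ffunP => l; rewrite sub_apply !ffunE -sumrB; apply: eq_bigr => k _.
by rewrite -mulrBr /aux_err sub_apply opprB addrC subrK.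
Qed.

Lemma G0_aux m : (m < M)%N ->
  G0 h a ht (aux_psi m) - A0 h a ht (err m) = G0 h a ht (wsum a (aux_err ^~ m)).
Proof. by move=> mM; rewrite wsum_aux// (symB (sym_G0 h a ht)). Qed.

Lemma wsum_aux_Hh m : (m < M)%N -> Hh (wsum a (aux_err ^~ m)).
Proof.
move=> mM; rewrite wsum_aux//; apply: HhB; first exact: aux_psi_Hh.
exact: B0_Hh.
Qed.

Lemma psi_Hh m : Hh (psi m).
Proof. by move=> l; rewrite finset.in_setC ffunE => /negbTE ->. Qed.

Lemma psi0_Hh : Hh psi0.
Proof. by move=> l; rewrite finset.in_setC ffunE => /negbTE ->. Qed.

Lemma err_step m : (0 < m < M)%N ->
  err m.+1 - err m - (err m - err m.-1) =
  ht ^+ 2 *: (psi m + G0 h a ht (aux_psi m) - A0 h a ht (err m)).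
Proof.
move=> m0M; have /andP[m0 mM] := m0M.
have mM' : (1 <= m <= M.-1)%N by rewrite m0 -ltnS (prednK M_gt0).
have HW := wsum_aux_Hh mM.
rewrite -[psi m + _ - _]addrA G0_aux//.
apply: Hh_eq => [||l lN].
- apply: HhB; apply: HhB; apply: err_Hh => //; first exact: ltnW.
    exact: ltnW.
  exact: leq_trans (leq_pred m) (ltnW mM).
- by apply/HhZ/HhD; [exact: psi_Hh|exact: G0_Hh].
rewrite -(I_plus_LhE h a ht HW) -/c.
have main := scheme_main sch mM' lN.
rewrite wsum_vv I_plus_Lh_subE in main.
set W := wsum a (aux_err ^~ m) in main HW *.
have -> : (err m.+1 - err m - (err m - err m.-1)) l =
    ht ^+ 2 * (Lam_t ht (U [::]) m l - Lam_t ht v m l).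
  rewrite !Du_nil /err [Lam_t _ _ _ _]ffunE [Lam_t ht v _ _]ffunE.
  rewrite !sub_apply; field; exact: lt0r_neq0.
rewrite {}main scale_apply add_apply [psi m l]ffunE lN.
rewrite [I_plus_Lh a h c W l]ffunE [I_plus_Lh a h c _ l]ffunE.
by rewrite -/c; ring.
Qed.

Lemma err_first : err 1 = ht *: (psi0 + (ht / 2) *: G0 h a ht (aux_psi 0)).
Proof.
have B00 : A0 h a ht (err 0) = 0 by rewrite err0 (sym0 (sym_A0 h_gt0 a ht)).
have := @G0_aux 0%N M_gt0; rewrite B00 subr0 => ->.
have HW := @wsum_aux_Hh 0%N M_gt0.
apply: Hh_eq => [||l lN].
- exact: err_Hh.
- by apply/HhZ/HhD; [exact: psi0_Hh|apply/HhZ/G0_Hh].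
rewrite -(I_plus_LhE h a ht HW) -/c.
have main := scheme_first sch lN.
rewrite wsum_vv I_plus_Lh_subE -/c in main.
set W := wsum a (aux_err ^~ _) in main HW *.
have -> : err 1 l = ht * (delta_t ht (U [::]) 0 l - delta_t ht v 0 l).
  have e0 : U [::] 0%N l = v 0%N l.
    by rewrite Du_nil; apply: subr0_eq; rewrite -sub_apply -/(err 0) err0 ffunE.
  rewrite [delta_t _ _ _ _]ffunE [delta_t ht v _ _]ffunE e0 Du_nil.
  rewrite /err sub_apply; field; exact: lt0r_neq0.
rewrite {}main scale_apply add_apply scale_apply [psi0 l]ffunE lN.
rewrite [I_plus_Lh a h c W l]ffunE [I_plus_Lh a h c _ l]ffunE.
by rewrite -/c; ring.
Qed.

(** Level 0 holds the residual of the first-level formula, where the auxiliary unknowns carry the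
    weight [h_t/2]. *)
Definition Psi m : V :=
  if m is 0 then psi0 + (ht / 2) *: G0 h a ht (aux_psi 0)
  else psi m + G0 h a ht (aux_psi m).

(** * Norms of the residuals and the final estimate *)

Variables (eps eps0 : R).
Hypotheses (eps01 : 0 <= eps < 1) (eps0_01 : 0 < eps0 < 1).
Hypothesis cfl : ht ^+ 2 / 3 * (\sum_k a k ^+ 2 / h k ^+ 2) <= 1 - eps.
Hypothesis stable : le_Hh (N := N) h (fun w => scale_mesh (ht ^+ 2 / 4) (Ah a h ht w))
  (fun w => scale_mesh (1 - eps0 ^+ 2) w).

Let kappa : R := Num.sqrt #|grid N|%:R.

Lemma nrm_sup w (d : R) : 0 <= d -> (forall l, `|w l| <= d) -> nrm w <= kappa * d.
Proof.
move=> d0 wd; rewrite /nrm -[X in _ * X]ger0_norm// -sqrtr_sqr -sqrtrM ?ler0n//.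
rewrite ler_wsqrtr// mulr_natl -sumr_const; apply: ler_sum => l _.
by rewrite -expr2 -[w l ^+ 2]real_normK ?num_real// ler_sqr ?nnegrE.
Qed.

Lemma h4_le k : h k ^+ 4 <= H2 ^+ 2.
Proof.
rewrite (exprM _ 2 2) ler_sqr ?nnegrE ?sqr_ge0// /H2; last first.
  by apply: sumr_ge0 => j _; exact: sqr_ge0.
by rewrite (bigD1 k)//= lerDl sumr_ge0// => j _; exact: sqr_ge0.
Qed.

Lemma B_ge0 : 0 <= B.
Proof.
apply: le_trans (normr_ge0 _) (HB (s := [::]) (p := (0, 0)) isT _).
by split=> [k|]; rewrite /= ?mxE lexx ltW.
Qed.

(** [9/2] is [3/2], the norm bound for the inverse Numerov averages, times 3, the constant of the
    Numerov residual; [G0] is a contraction. *)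
Lemma nrm_G0_aux m : (m <= M)%N ->
  nrm (G0 h a ht (aux_psi m)) <= kappa * (9 / 2 * B * S * H2 ^+ 2).
Proof.
move=> mM; have eps_ge0 : 0 <= eps by case/andP: eps01.
apply: le_trans (nrm_G0 h_gt0 eps_ge0 cfl _) _.
apply: le_trans (nrm_sum _) _; rewrite /S mulrAC !mulr_sumr.
apply: ler_sum => k _; rewrite nrmZ ger0_norm ?sqr_ge0//.
have : nrm (tN k (psik k m)) <= 3 / 2 * (kappa * (3 * B * H2 ^+ 2)).
  apply: le_trans (nrm_tN h_gt0 k _) _; rewrite ler_wpM2l//.
  have hb l : `|psik k m l| <= 3 * B * H2 ^+ 2.
    have [lN|lN] := boolP (l \in omega_h N); last first.
      rewrite psik_Hh ?finset.in_setC// normr0; apply: mulr_ge0; last exact: sqr_ge0.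
      by apply: mulr_ge0 => //; exact: B_ge0.
    rewrite /psik sub_apply; apply: le_trans (trunc_sN k mM lN) _.
    by rewrite ler_wpM2l ?h4_le// mulr_ge0 ?B_ge0.
  apply: nrm_sup => //; apply: mulr_ge0; last exact: sqr_ge0.
  by apply: mulr_ge0 => //; exact: B_ge0.
move=> H; apply: le_trans (ler_wpM2l (sqr_ge0 (a k)) H) _.
by rewrite le_eqVlt; apply/orP; left; apply/eqP; field.
Qed.

Variable q : R.
Hypothesis ht_q : ht ^+ 2 <= q * H2.

(** The summands bound the auxiliary residuals, [psi] and [psi0]. The factor [1 + T] serves both the
    weight 1 at later levels and the weight [h_t/2 <= T] at level 0. *)
Definition Cpsi : R := (1 + T) * (9 / 2 * B * S) +
  (2 * B * q ^+ 2 + q * (2 * B * S + 2 * ((1 + S) * B) * q)) +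
  (B * q ^+ 2 + (q * (2 * B * S) + T * q * (2 * B * S) + `|Cd| * q ^+ 2)).

Lemma nrm_Psi m : (m < M)%N -> nrm (Psi m) <= kappa * (Cpsi * H2 ^+ 2).
Proof.
move=> mM.
have B0 := B_ge0.
have S0 : 0 <= S by apply: sumr_ge0 => k _; exact: sqr_ge0.
have H20 : 0 <= H2 by apply: sumr_ge0 => k _; exact: sqr_ge0.
have k0 : 0 <= kappa by exact: sqrtr_ge0.
have y0 : 0 < q * H2 by apply: lt_le_trans ht_q; rewrite exprn_gt0.
have q0 : 0 <= q.
  by rewrite leNgt; apply/negP => qlt; move: y0; rewrite ltNge mulr_le0_ge0// ltW.
have x0 : 0 <= ht ^+ 2 by exact: sqr_ge0.
have htT : ht <= T by rewrite -htM ler_peMl ?(ltW ht_gt0)// ler1n.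
have ht0 := ltW ht_gt0; have T0 := ltW T_gt0.
have tT : 0 <= ht <= T by rewrite ht0.
have K0 : 0 <= 9 / 2 * B * S by rewrite !mulr_ge0.
have C0 : 0 <= `|Cd| by exact: normr_ge0.
have c1 : 0 <= 2 * B * q ^+ 2 + q * (2 * B * S + 2 * ((1 + S) * B) * q).
  by rewrite !(addr_ge0, mulr_ge0).
have c2 : 0 <= B * q ^+ 2 + (q * (2 * B * S) + T * q * (2 * B * S) + `|Cd| * q ^+ 2).
  by rewrite !(addr_ge0, mulr_ge0).
have aux := nrm_G0_aux (ltnW mM); have aux0 := nrm_G0_aux (leq0n M).
rewrite /Cpsi.
set Y := H2 ^+ 2 in aux aux0 *; have Y0 : 0 <= Y by exact: sqr_ge0.
set k1 := 9 / 2 * B * S in K0 aux aux0 *; set k2 := _ + q * _ in c1 *.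
set k3 := B * _ + _ in c2 *.
case: m mM aux => [|m] mM aux.
  apply: le_trans (nrmD _ _) _; rewrite nrmZ (ger0_norm (divr_ge0 ht0 _))//.
  have h1 : nrm psi0 <= kappa * (k3 * Y).
    apply: nrm_sup => [|l]; first exact: mulr_ge0.
    by apply: le_trans (psi0_bound l) _; exact: first_arith.
  have h2 : ht / 2 * nrm (G0 h a ht (aux_psi 0)) <= T * (kappa * (k1 * Y)).
    by apply: ler_pM => //; [exact: divr_ge0|exact: nrm_ge0|lra].
  apply: le_trans (lerD h1 h2) _; rewrite [T * _]mulrCA -mulrDr ler_wpM2l//.
  by rewrite [T * _]mulrA -mulrDl ler_wpM2r//; lra.
apply: le_trans (nrmD _ _) _.
have h1 : nrm (psi m.+1) <= kappa * (k2 * Y).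
  apply: nrm_sup => [|l]; first exact: mulr_ge0.
  apply: le_trans (@psi_bound m.+1 l mM) _.
  by rewrite (exprM ht 2 2); exact: interior_arith.
apply: le_trans (lerD h1 aux) _; rewrite -mulrDr ler_wpM2l// -mulrDl ler_wpM2r//.
have Tk1 := mulr_ge0 T0 K0.
have -> : (1 + T) * k1 + k2 + k3 = (k2 + k1) + (T * k1 + k3) by ring.
by rewrite lerDl addr_ge0.
Qed.

Hypothesis N_gt0 : forall k, (0 < N k)%N.

(** [h_k (N_k + 1) = X_k + h_k <= 2 X_k]: the weight of the inner product offsets the number of
    nodes. *)
Lemma kappa_bound :
  Num.sqrt (\prod_k h k) * kappa <= Num.sqrt (\prod_k (2 * X k)).
Proof.
rewrite -sqrtrM ?prodr_ge0// => [|k _]; last exact: ltW.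
rewrite ler_wsqrtr// card_dep_ffun foldrE big_map big_enum /= natr_prod -big_split /=.
apply: ler_prod => k _; rewrite card_ord mulr_ge0 ?(ltW (h_gt0 k))//=.
have := h_gt0 k; have : h k <= X k.
  by rewrite -hN ler_peMl ?ler1n// ltW.
by rewrite -natr1 mulrDr mulr1 (mulrC (h k)) hN; lra.
Qed.

Lemma err_bound m : (m < M)%N ->
  eps0 * norm_h h (bdelta_t ht err m.+1) +
    Num.sqrt eps * norm_Lh a h (bs_t err m.+1) <=
  2 * (Num.sqrt (\prod_k (2 * X k)) * (Cpsi * (1 + T / eps0))) * H2 ^+ 2.
Proof.
move=> mM; have /andP[eps_ge0 eps_lt1] := eps01; have /andP[eps0_gt0 _] := eps0_01.
have P0 : 0 < \prod_k h k by exact: prodr_gt0.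
have [d dE] : exists d, d = kappa * (Cpsi * H2 ^+ 2) by exists (kappa * (Cpsi * H2 ^+ 2)).
have Psi_d := nrm_Psi; rewrite -dE in Psi_d.
have d0 : 0 <= d by apply: le_trans (Psi_d m mM); exact: nrm_ge0.
have stab m' : (m' < M)%N ->
    ht ^+ 2 / 4 * dot (A0 h a ht (err m'.+1 - err m')) (err m'.+1 - err m') <=
    (1 - eps0 ^+ 2) * dot (err m'.+1 - err m') (err m'.+1 - err m').
  move=> m'M; have Hw : Hh (err m'.+1 - err m').
    by apply: HhB; apply: err_Hh => //; exact: ltnW.
  have := stable Hw; rewrite !inner_hE// AhE//.
  have scaleE x (w : V) : scale_mesh x w = x *: w by apply/ffunP => l; rewrite !ffunE.
  by rewrite !scaleE !dotZl ler_pM2l.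
have step m' : (0 < m' < M)%N -> err m'.+1 - err m' - (err m' - err m'.-1) =
    ht ^+ 2 *: (Psi m' - A0 h a ht (err m')).
  by case: m' => // m' m'M; exact: err_step.
have := @energy_bound R _ (A0 h a ht) (fun w => - Lh0 h a w) err Psi M ht eps eps0 d
  ht_gt0 eps_ge0 eps0_gt0 d0 (sym_A0 h_gt0 a ht) (psdN_Lh0 h a)
  (A0_ge h_gt0 eps_ge0 cfl) stab err0 err_first step Psi_d m mM.
set D := ht^-1 *: _; set s := 2^-1 *: _ => En.
have HD : Hh D by apply/HhZ/HhB; apply: err_Hh => //; exact: ltnW.
have Hs : Hh s by apply/HhZ/HhD; apply: err_Hh => //; exact: ltnW.
pose Z := d * (1 + T / eps0).
have Z0 : 0 <= Z by rewrite mulr_ge0// addr_ge0// divr_ge0// ltW.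
have {}En : eps0 ^+ 2 * dot D D + eps * dot (- Lh0 h a s) s <= Z ^+ 2.
  apply: le_trans En _.
  (* The increments of [m] steps add up over a time [m h_t <= T]. *)
  have mT : m%:R * (ht * d / eps0) <= d * (T / eps0).
    have -> : m%:R * (ht * d / eps0) = d / eps0 * (m%:R * ht) by ring.
    have -> : d * (T / eps0) = d / eps0 * T by ring.
    rewrite ler_wpM2l ?divr_ge0 ?(ltW eps0_gt0)// -htM.
    by rewrite ler_wpM2r ?(ltW ht_gt0)// ler_nat ltnW.
  apply: lerXn2r; rewrite ?nnegrE// /Z ?mulrDr ?mulr1 ?lerD2l//.
  by rewrite addr_ge0// mulr_ge0// divr_ge0 ?mulr_ge0// ltW.
have L0 := psdN_Lh0 h a s.
(* Each of the two energy terms is bounded by [Z^2] separately, whence the factor 2 in the final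
   constant. *)
have eD : eps0 * nrm D <= Z.
  apply: le_of_sqr => //; rewrite exprMn sqr_nrm.
  by apply: le_trans En; rewrite lerDl mulr_ge0.
have eL : Num.sqrt eps * Num.sqrt (dot (- Lh0 h a s) s) <= Z.
  apply: le_of_sqr => //; rewrite exprMn !sqr_sqrtr//.
  by apply: le_trans En; rewrite lerDr mulr_ge0 ?sqr_ge0 ?dot_ge0.
have -> : norm_h h (bdelta_t ht err m.+1) = Num.sqrt (\prod_k h k) * nrm D.
  rewrite /norm_h /nrm -sqrtrM ?(ltW P0)// -inner_hE//; congr (Num.sqrt (inner_h h _ _));
    by apply/ffunP => l; rewrite /D scale_apply sub_apply [LHS]ffunE mulrC.
have -> : norm_Lh a h (bs_t err m.+1) =
    Num.sqrt (\prod_k h k) * Num.sqrt (dot (- Lh0 h a s) s).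
  have -> : bs_t err m.+1 = s.
    by apply/ffunP => l; rewrite /s scale_apply add_apply [LHS]ffunE mulrC.
  by rewrite /norm_Lh -sqrtrM ?(ltW P0)// -inner_hE// Lh0E.
have Pk := kappa_bound; set P := Num.sqrt (\prod_k h k) in Pk *.
have sP0 : 0 <= P by exact: sqrtr_ge0.
(* The grid is nonempty; dividing [0 <= d] by [kappa] then gives the sign of [Cpsi * H2 ^+ 2]. *)
have kgt0 : 0 < kappa.
  rewrite sqrtr_gt0 ltr0n; apply/card_gt0P.
  by exists [ffun k => ord0].
have CH : 0 <= Cpsi * H2 ^+ 2 by move: d0; rewrite dE pmulr_rge0.
apply: (@le_trans _ _ (2 * (P * Z))).
  have := ler_wpM2l sP0 eD; have := ler_wpM2l sP0 eL.
  rewrite (mulrCA eps0) (mulrCA (Num.sqrt eps)) => lL lD.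
  by apply: le_trans (lerD lD lL) _; rewrite mulr_natl mulr2n.
have E1 : 0 <= 1 + T / eps0 by rewrite addr_ge0// divr_ge0// ltW.
have -> : 2 * (P * Z) = 2 * (P * kappa * (Cpsi * H2 ^+ 2 * (1 + T / eps0))).
  by rewrite /Z dE; ring.
rewrite -[leRHS]mulrA ler_wpM2l//.
have -> : Num.sqrt (\prod_k (2 * X k)) * (Cpsi * (1 + T / eps0)) * H2 ^+ 2 =
  Num.sqrt (\prod_k (2 * X k)) * (Cpsi * H2 ^+ 2 * (1 + T / eps0)) by ring.
by rewrite ler_wpM2r// mulr_ge0.
Qed.

End MeshConsistency.

Theorem theorem2 (R : realType) :
  exists K : nat,
  forall (n : nat) (a X : 'I_n -> R) (T : R),
    (1 <= n)%N ->
    (forall k, 0 < a k) -> (forall k, 0 < X k) -> 0 < T ->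
  forall (u f g : 'rV[R]_n * R -> R) (u0 u1 : 'rV[R]_n -> R),
    smooth_upto X T K u ->
    ibvp a X T u f g u0 u1 ->
  forall eps eps0 Cd : R,
    0 <= eps < 1 -> 0 < eps0 < 1 ->
  exists C : R,
  forall (M : nat) (N : 'I_n -> nat),
    (2 <= M)%N -> (forall k, (2 <= N k)%N) ->
  let ht : R := T / M%:R in
  let h : 'I_n -> R := fun k => X k / (N k)%:R in
    ht ^+ 2 / 3 * (\sum_(k < n) a k ^+ 2 / h k ^+ 2) <= 1 - eps ->
    le_Hh (N := N) h (fun w => scale_mesh (ht ^+ 2 / 4) (Ah a h ht w))
      (fun w => scale_mesh (1 - eps0 ^+ 2) w) ->
  forall (fd : meshfun R N) (v : nat -> meshfun R N)
      (vv : 'I_n -> nat -> meshfun R N),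
    (forall l, l \in omega_h N ->
      let p := (node h l, 0) in
      `|fd l - (f p + ht / 3 * pd X T None f p
                + ht ^+ 2 / 12 * pd2 X T None f p)| <= Cd * ht ^+ 3) ->
    scheme M a X T h ht f g u0 u1 fd v vv ->
  let r : nat -> meshfun R N := fun m => restr_t N h ht u m - v m in
  \big[Num.max/0]_(1 <= m < M.+1)
     (eps0 * norm_h h (bdelta_t ht r m)
      + Num.sqrt eps * norm_Lh a h (bs_t r m))
    <= C * Num.sqrt (\sum_(k < n) h k ^+ 2) ^+ 4.
Proof.
(* Order 6 is that of the Taylor remainders in [numerov] and [second_difference6]. *)
exists 6%N => n a X T n_gt0 a_gt0 X_gt0 T_gt0 u f g u0 u1 smooth_u ibvp_u.
move=> eps eps0 Cd eps01 eps0_01.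
have [B _ HB] := Du_bounded smooth_u.
(* A single term of the first mesh condition gives [h_t^2 <= 3 h_k0^2 / a_k0^2]. *)
pose k0 := Ordinal n_gt0; pose q := 3 / a k0 ^+ 2.
exists (2 * (Num.sqrt (\prod_k (2 * X k)) * (Cpsi a T B Cd q * (1 + T / eps0)))).
move=> M N M2 N2 ht h cfl stable fd v vv fd_approx sch; cbv zeta.
have M_gt0 : (0 < M)%N := ltnW M2; have N_gt0 k : (0 < N k)%N := ltnW (N2 k).
have ht_gt0 : 0 < ht by rewrite divr_gt0// ltr0n.
have h_gt0 k : 0 < h k by rewrite divr_gt0// ltr0n.
have hN k : (N k)%:R * h k = X k by rewrite mulrC divfK// pnatr_eq0 -lt0n.
have htM : M%:R * ht = T by rewrite mulrC divfK// pnatr_eq0 -lt0n.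
have H20 : 0 <= \sum_k h k ^+ 2 by apply: sumr_ge0 => k _; exact: sqr_ge0.
have ht_q : ht ^+ 2 <= q * \sum_k h k ^+ 2.
  have a2 : 0 < a k0 ^+ 2 by rewrite exprn_gt0.
  have h2 : 0 < h k0 ^+ 2 by rewrite exprn_gt0.
  have : ht ^+ 2 / 3 * (a k0 ^+ 2 / h k0 ^+ 2) <= 1.
    apply: le_trans (_ : 1 - eps <= 1); last by case/andP: eps01; lra.
    apply: le_trans cfl; rewrite ler_wpM2l ?divr_ge0 ?sqr_ge0// (bigD1 k0)//= lerDl.
    by apply: sumr_ge0 => k _; rewrite divr_ge0 ?sqr_ge0.
  rewrite mulrA ler_pdivrMr// mul1r mulrAC ler_pdivrMr// => H.
  rewrite /q mulrAC ler_pdivlMr//; apply: le_trans H _.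
  rewrite mulrC ler_wpM2l// (bigD1 k0)//= lerDl.
  by apply: sumr_ge0 => k _; exact: sqr_ge0.
rewrite (exprM _ 2 2) sqr_sqrtr// big_nat_cond.
have bound m : (m < M)%N -> _ := err_bound X_gt0 T_gt0 h_gt0 ht_gt0 hN htM smooth_u
  ibvp_u HB M_gt0 fd_approx a_gt0 sch eps01 eps0_01 cfl stable ht_q N_gt0 (m := m).
(* The maximum starts from 0, so the bound must be shown nonnegative; this follows from the estimate
   at the first level. *)
apply: bigmax_le => [|m].
  apply: le_trans (bound 0%N M_gt0).
  by rewrite addr_ge0// mulr_ge0 ?sqrtr_ge0//; case/andP: eps0_01 => /ltW.
by rewrite andbT; case: m => // m /andP[_ mM]; exact: bound.
Qed.
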